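(* Let $n\geqslant 2$, let $x_1,\ldots,x_{n-1}>0$ be real numbers, and put \[ u_i=x_i^{-1}\quad(i<n),\qquad u_n=-\Bigl(\sum_{i<n}x_i\Bigr)^{-1},\qquad \mathbf u=(u_1,\ldots,u_n), \] \[ \omega=\sum_{i<n}x_i^2+\sum_{i<j<n}x_ix_j,\qquad \mathcal T=\Bigl(\sum_{i<n}x_i\Bigr)\sum_{i<n}x_i(i\,n)-\sum_{i<j<n}x_ix_j(i\,j)\in\mathbb C[\mathfrak S_n]. \] Then $\mathscr P^{(2,2)}(\mathbf u)\succeq 0$ if and only if \[ -\omega\,1\preceq\mathcal T\preceq\omega\,1 . \] Equivalently, every unitary representation $\rho$ of $\mathfrak S_n$ satisfies $\lVert\rho(\mathcal T)\rVert_{\mathrm{op}}\leqslant\omega$. Both endpoints are attained: each of $\omega$ and $-\omega$ is an eigenvalue of $\rho(\mathcal T)$ for some unitary representation $\rho$ of $\mathfrak S_n$.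
   Context: Here $1$ is the identity of $\mathbb C[\mathfrak S_n]$ and $(i\,j)$ denotes a transposition. Let $*$ be the antilinear involution on $\mathbb C[\mathfrak S_n]$ with $\sigma^*=\sigma^{-1}$. For self-adjoint $A,B\in\mathbb C[\mathfrak S_n]$, write $A\succeq 0$ if $\rho(A)$ is positive semidefinite in every (finite-dimensional) unitary representation $\rho$ of $\mathfrak S_n$, and $A\preceq B$ if $B-A\succeq 0$. Let $[n]=\{1,\ldots,n\}$ and for $X\subseteq[n]$ regard $\mathfrak S_X$ as the subgroup of $\mathfrak S_n$ fixing the complement of $X$. For a partition $\lambda\vdash k$, let $\chi^\lambda$ be the character of the complex Specht module $S^\lambda$ (so $S^{(k)}$ is trivial and $S^{(1^k)}$ is sign). For $\mathbf u=(u_1,\ldots,u_n)\in\mathbb C^n$, the universal Plücker coordinate is \[ \mathscr P^\lambda(\mathbf u)=\sum_{\substack{X\subseteq[n]\\|X|=k}}\Bigl(\sum_{\sigma\in\mathfrak S_X}\chi^\lambda(\sigma)\sigma\Bigr)\prod_{a\in[n]\setminus X}u_a\in\mathbb C[\mathfrak S_n],\] with $\mathscr P^\lambda(\mathbf u)=0$ when $k>n$. *)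

(* Defs.v *)
From HB Require Import structures.
From mathcomp Require Import all_boot all_order all_algebra all_fingroup.
From mathcomp Require Import sesquilinear spectral mxrepresentation.
From mathcomp Require Import classical_sets reals complex.

Set Implicit Arguments.
Unset Strict Implicit.
Unset Printing Implicit Defensive.

Import Order.TTheory GRing.Theory Num.Theory.
Local Open Scope ring_scope.
Local Open Scope complex_scope.

(* An element of C[S_n] is its coefficient function. The library makes finite
   functions a module and also a ring for the POINTWISE product; that product
   is not the one of C[S_n] and is never used: the identity of C[S_n] is
   [gelt 1], not [1]. *)
Notation galg R n := {ffun 'S_n -> R[i]^o}.

Definition gelt (R : realType) (n : nat) (s : 'S_n) : galg R n :=
  [ffun t => (t == s)%:R].

Definition gstar (R : realType) (n : nat) (A : galg R n) : galg R n :=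
  [ffun s => (A s^-1%g)^*].

(* Matrices act on row vectors and [s * t] is "s, then t" in the library, so a
   representation [rG] here is the transpose of one for right-to-left
   composition; unitarity, positivity, operator norm and spectrum are
   unaffected. *)
Definition unitary_repr (R : realType) (n d : nat)
    (rG : mx_representation R[i] [set: 'S_n] d) : Prop :=
  forall s, rG s \is unitarymx.

Definition galg_repr (R : realType) (n d : nat)
    (rG : mx_representation R[i] [set: 'S_n] d) (A : galg R n) : 'M[R[i]]_d :=
  \sum_(s : 'S_n) A s *: rG s.

(* On R[i], [0 <= z] says that z is real and nonnegative. *)
Definition psdmx (R : realType) (d : nat) (M : 'M[R[i]]_d) : Prop :=
  M \is hermsymmx /\ forall v : 'rV_d, 0 <= dotmx (v *m M) v.

Definition gself_adjoint (R : realType) (n : nat) (A : galg R n) : Prop :=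
  gstar A = A.

Definition gpsd (R : realType) (n : nat) (A : galg R n) : Prop :=
  gself_adjoint A /\
  forall (d : nat) (rG : mx_representation R[i] [set: 'S_n] d),
    unitary_repr rG -> psdmx (galg_repr rG A).

Definition gle (R : realType) (n : nat) (A B : galg R n) : Prop :=
  [/\ gself_adjoint A, gself_adjoint B & gpsd (B - A)].

Definition l2norm (R : realType) (d : nat) (v : 'rV[R[i]]_d) : R :=
  Num.sqrt (complex.Re (dotmx v v)).

(* The supremum over the closed unit ball, which is nonempty even if d = 0. *)
Definition opnorm (R : realType) (d : nat) (M : 'M[R[i]]_d) : R :=
  sup [set l2norm (v *m M) | v in [set v : 'rV[R[i]]_d | l2norm v <= 1]]%classic.

(* Specht modules (James' construction), for the symmetric group of an
   arbitrary finite set T, so that they apply directly to each S_X.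
   A partition [la] is the nonincreasing sequence of its positive parts. *)
Section Specht.
Variables (R : realType) (T : finType) (la : seq nat).

(* A cell is (row, column); rows and columns are numbered from 0. *)
Definition cell := ('I_(size la) * 'I_(sumn la))%type.

Definition diagram : {set cell} := [set c : cell | (c.2 < nth 0 la c.1)%N].

(* A tableau is given by the cell in which each entry sits. *)
Definition is_tableau (t : {ffun T -> cell}) : bool :=
  injectiveb t && (t @: [set: T] == diagram).

(* A tabloid is given by the row in which each entry sits. *)
Definition tabloid := {ffun T -> 'I_(size la)}.

Definition tabloid_of (t : {ffun T -> cell}) : tabloid := [ffun x => (t x).1].

(* Complex combinations of tabloids. Row assignments whose row sizes are not
   given by [la] do not occur in any polytabloid. *)
Definition tabloid_space := {ffun tabloid -> R[i]^o}.

(* The left permutation action: the entry s x takes the place of x, that is,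
   s sends the tabloid psi o s to the tabloid psi. *)
Definition tabloid_act (s : {perm T}) (f : tabloid_space) : tabloid_space :=
  [ffun psi : tabloid => f [ffun x => psi (s x)]].

Definition column_stabilizer (t : {ffun T -> cell}) : {set {perm T}} :=
  [set s : {perm T} | [forall x, (t (s x)).2 == (t x).2]].

Definition polytabloid (t : {ffun T -> cell}) : tabloid_space :=
  \sum_(s in column_stabilizer t)
    (-1) ^+ s *: tabloid_act s [ffun psi => (psi == tabloid_of t)%:R].

Definition specht : {vspace tabloid_space} :=
  <<[seq polytabloid t | t <- enum is_tableau]>>%VS.

(* The trace of the action on [specht]. *)
Definition specht_char (s : {perm T}) : R[i] :=
  \sum_(i < \dim specht)
    coord (vbasis specht) i (tabloid_act s (vbasis specht)`_i).

End Specht.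

(* S_X is the group of permutations of the subtype {a | a \in X}; it is
   embedded in S_n by fixing the complement of X. *)
Section Embedding.
Variables (n : nat) (X : {set 'I_n}).

Definition extend_fun (s : {perm {a : 'I_n | a \in X}}) (a : 'I_n) : 'I_n :=
  if insub a is Some b then val (s b) else a.

Lemma extend_fun_inj s : injective (extend_fun s).
Proof.
move=> a b; rewrite /extend_fun.
case: insubP => [a' Xa <-|Xa]; case: insubP => [b' Xb <-|Xb] //.
- by move=> /val_inj/perm_inj ->.
- by move=> eb; move: Xb; rewrite -eb (valP (s a')).
- by move=> ea; move: Xa; rewrite ea (valP (s b')).
Qed.

Definition extend_perm (s : {perm {a : 'I_n | a \in X}}) : 'S_n :=
  perm (@extend_fun_inj s).

End Embedding.

Definition plucker (R : realType) (n : nat) (la : seq nat)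
    (u : 'I_n -> R[i]) : galg R n :=
  \sum_(X : {set 'I_n} | #|X| == sumn la)
    (\prod_(a in ~: X) u a) *:
      \sum_(s : {perm {a : 'I_n | a \in X}})
        specht_char R la s *: gelt R (extend_perm s).

(* Below n = m.+1: the indices i < n of x are the elements of 'I_m, the last
   index is [ord_max] and i : 'I_m is seen in 'I_m.+1 as [lift ord_max i], which
   has the same value. *)
Section Data.
Variables (R : realType) (m : nat) (x : 'I_m -> R).

Definition weight_u (a : 'I_m.+1) : R[i] :=
  (if unlift ord_max a is Some i then (x i)^-1
   else - (\sum_(i < m) x i)^-1)%:C.

Definition omega : R :=
  \sum_(i < m) x i ^+ 2 + \sum_(i < m) \sum_(j < m | (i < j)%N) x i * x j.

Definition calT : galg R m.+1 :=
  (\sum_(i < m) x i)%:C *: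
    (\sum_(i < m) (x i)%:C *: gelt R (tperm (lift ord_max i) ord_max))
  - \sum_(i < m) \sum_(j < m | (i < j)%N)
      (x i * x j)%:C *: gelt R (tperm (lift ord_max i) (lift ord_max j)).

Definition gomega : galg R m.+1 := omega%:C *: gelt R 1%g.

End Data.

(* Main.v *)
(* The square-shape coordinate factors.  Put y_i = 1 / u_i, so that y_i = x_i for
   i < n, y_n = - sum_{i<n} x_i and sum_i y_i = 0.  Then T is minus the sum over
   i < j of y_i y_j (i j), omega is half the sum of the y_i ^ 2, and
     Q = sum_{a,b} y_a y_b (a b) = 2 (omega - T).
   The character of S^(2,2) is the trace on the span of differences of the three
   pairings of a four-element set, i.e. the number of fixed pairings minus one, so
   the character element of a four-element set is twice the sum of its Klein
   four-group minus the sum of its 3-cycles.  Expanding Q^2 by the coincidences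
   among the four indices, and using sum_i y_i = 0 to trade a repeated index for a
   fresh one, gives 4 P^(2,2)(u) = U (Q^2 - 4 omega Q), where U = prod_i u_i, that
   is, P^(2,2)(u) = (- U) (omega^2 - T^2) with - U > 0.

   It remains to compare omega^2 - M^2 >= 0 with - omega <= M <= omega for a
   hermitian matrix M; no spectral theorem is needed because
     2 omega (omega^2 - M^2) = (omega - M) (omega + M) (omega - M)
                             + (omega + M) (omega - M) (omega + M),
     2 omega (omega -+ M) = (omega -+ M)^2 + (omega^2 - M^2).
   The endpoints omega and - omega occur in the trivial and sign representations. *)
From HB Require Import structures.
Require Import Defs.
From mathcomp Require Import all_boot all_order all_algebra all_fingroup.
From mathcomp Require Import sesquilinear spectral mxrepresentation.
From mathcomp Require Import reals complex ring zify.

Set Implicit Arguments.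
Unset Strict Implicit.
Unset Printing Implicit Defensive.

Import Order.TTheory GRing.Theory Num.Theory.
Local Open Scope ring_scope.
Local Open Scope complex_scope.

(** * The character of the square shape *)

(** Cyclicity of the trace: the first hypothesis factors the identity of [V] through [I]-indexed
    coordinates, and the two factors may be swapped around [g]. It replaces the abstract [vbasis] in
    [specht_char] by an explicit family. *)
Lemma trace_dual_family (K : fieldType) (vT : vectType K) (V : {vspace vT})
    (I : finType) (b : I -> vT) (phi : I -> {linear vT -> K^o})
    (g : {linear vT -> vT}) :
  (forall v, v \in V -> v = \sum_j phi j v *: b j) ->
  (forall j, g (b j) \in V) ->
  \sum_(i < \dim V) coord (vbasis V) i (g (vbasis V)`_i)
    = \sum_j phi j (g (b j)).
Proof.
move=> dual gV.
under eq_bigr => i _.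
  rewrite [X in g X]dual; last by rewrite vbasis_mem // mem_nth ?size_tuple.
  rewrite linear_sum linear_sum.
  under eq_bigr do rewrite linearZ linearZ /=.
  over.
rewrite exchange_big; apply: eq_bigr => j _ /=.
rewrite [in RHS](coord_vbasis (gV j)) linear_sum; apply: eq_bigr => i _.
by rewrite linearZ /= -[RHS]mulrC.
Qed.

Lemma dual_family_span (K : fieldType) (vT : vectType K) (X : seq vT)
    (I : finType) (b : I -> vT) (phi : I -> {linear vT -> K^o}) :
  (forall v, v \in X -> v = \sum_j phi j v *: b j) ->
  forall v, v \in <<X>>%VS -> v = \sum_j phi j v *: b j.
Proof.
move=> dual v /(@coord_span _ _ _ (in_tuple X)) ->.
under [RHS]eq_bigr do rewrite linear_sum scaler_suml.
rewrite exchange_big; apply: eq_bigr => i _ /=.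
rewrite [in LHS](dual X`_i) ?mem_nth // scaler_sumr.
by apply: eq_bigr => j _; rewrite scalerA linearZ_LR.
Qed.

Lemma tabloid_act_is_linear (R : realType) (T : finType) (la : seq nat)
    (s : {perm T}) :
  linear (tabloid_act s : tabloid_space R T la -> tabloid_space R T la).
Proof. by move=> c f g; apply/ffunP => psi; rewrite !ffunE. Qed.

HB.instance Definition _ R T la s :=
  GRing.isLinear.Build _ _ _ _ (@tabloid_act R T la s)
    (@tabloid_act_is_linear R T la s).

Section Eval.
Variables (R : realType) (T : finType) (la : seq nat).
Definition tabloid_eval (psi : tabloid T la) (f : tabloid_space R T la) :
  R[i]^o := f psi.

Lemma tabloid_eval_is_linear psi : linear (tabloid_eval psi).
Proof. by move=> c f g; rewrite /tabloid_eval !ffunE. Qed.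

HB.instance Definition _ psi :=
  GRing.isLinear.Build _ _ _ _ (tabloid_eval psi) (tabloid_eval_is_linear psi).
End Eval.

Lemma uniq4_neq (T : eqType) (x y z w : T) : uniq [:: x; y; z; w] ->
  ((x == y) = false) * ((x == z) = false) * ((x == w) = false) *
  ((y == x) = false) * ((y == z) = false) * ((y == w) = false) *
  ((z == x) = false) * ((z == y) = false) * ((z == w) = false) *
  ((w == x) = false) * ((w == y) = false) * ((w == z) = false).
Proof.
rewrite /= !inE !negb_or => /and4P[/and3P[xy xz xw] /andP[yz yw] zw _].
by do !split; apply/negbTE; rewrite // eq_sym.
Qed.

(** The 24 orderings of four letters, packaged so that one case analysis substitutes all four
    variables at once. *)
Variant arrangement (T : Type) (a b c d : T) : T -> T -> T -> T -> Prop :=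
  | Arrangement_abcd : arrangement a b c d a b c d
  | Arrangement_abdc : arrangement a b c d a b d c
  | Arrangement_acbd : arrangement a b c d a c b d
  | Arrangement_acdb : arrangement a b c d a c d b
  | Arrangement_adbc : arrangement a b c d a d b c
  | Arrangement_adcb : arrangement a b c d a d c b
  | Arrangement_bacd : arrangement a b c d b a c d
  | Arrangement_badc : arrangement a b c d b a d c
  | Arrangement_bcad : arrangement a b c d b c a d
  | Arrangement_bcda : arrangement a b c d b c d a
  | Arrangement_bdac : arrangement a b c d b d a c
  | Arrangement_bdca : arrangement a b c d b d c a
  | Arrangement_cabd : arrangement a b c d c a b d
  | Arrangement_cadb : arrangement a b c d c a d b
  | Arrangement_cbad : arrangement a b c d c b a d
  | Arrangement_cbda : arrangement a b c d c b d a
  | Arrangement_cdab : arrangement a b c d c d a b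
  | Arrangement_cdba : arrangement a b c d c d b a
  | Arrangement_dabc : arrangement a b c d d a b c
  | Arrangement_dacb : arrangement a b c d d a c b
  | Arrangement_dbac : arrangement a b c d d b a c
  | Arrangement_dbca : arrangement a b c d d b c a
  | Arrangement_dcab : arrangement a b c d d c a b
  | Arrangement_dcba : arrangement a b c d d c b a.

Lemma arrangementP (T : eqType) (a b c d x y z w : T) :
  (forall u, u \in [:: a; b; c; d]) -> uniq [:: x; y; z; w] ->
  arrangement a b c d x y z w.
Proof.
move=> E U; have ne (u v : T) : (u == v) = false -> u <> v by move/eqP.
have N := uniq4_neq U; have [xy xz xw] : [/\ x <> y, x <> z & x <> w].
  by split; apply: ne; rewrite N.
have [yz yw zw] : [/\ y <> z, y <> w & z <> w] by split; apply: ne; rewrite N.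
have := E x; have := E y; have := E z; have := E w; rewrite !inE.
move=> {E ne N U} Hw Hz Hy.
case/or4P => /eqP ?; subst x; case/or4P: Hy => /eqP ?; subst y; try by [];
  case/or4P: Hz => /eqP ?; subst z; try by []; case/or4P: Hw => /eqP ?;
  subst w; try by []; constructor.
Qed.

Lemma tperm_if (T : finType) (x y z : T) :
  tperm x y z = if z == x then y else if z == y then x else z.
Proof.
case: tpermP => [->|->|/eqP/negbTE-> /eqP/negbTE-> //]; rewrite eqxx //.
by case: eqP.
Qed.

(** * Polytabloids of shape (2,2) as differences of pairings *)

Section SquareShape.
Variables (R : realType) (T : finType).
Notation sq := [:: 2; 2]%N.
Implicit Types (x y z w u : T) (s : {perm T}) (psi : tabloid T sq).

Definition enumerates x y z w :=
  uniq [:: x; y; z; w] /\ forall u, u \in [:: x; y; z; w].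

(** There are only two rows, so this is the sum of the two tabloids with rows {x,y} and {z,w} in
    either order: the unordered pairing xy|zw. *)
Definition pairing x y z w : tabloid_space R T sq :=
  [ffun psi : tabloid T sq =>
    [&& psi x == psi y, psi z == psi w & psi x != psi z]%:R].

Lemma tabloid_act_pairing s x y z w :
  tabloid_act s (pairing x y z w) = pairing (s x) (s y) (s z) (s w).
Proof. by apply/ffunP => psi; rewrite !ffunE. Qed.

Definition sqcell (i j : nat) : cell sq := (inord i, inord j).

Lemma enumerates_permP x y z w s s' : enumerates x y z w ->
  s x = s' x -> s y = s' y -> s z = s' z -> s w = s' w -> s = s'.
Proof.
move=> [_ E] ex ey ez ew; apply/permP => u.
by have := E u; rewrite !inE => /or4P[]/eqP->.
Qed.

Lemma column_stabilizer_square (t : {ffun T -> cell sq}) x y z w :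
  enumerates x y z w ->
  t x = sqcell 0 0 -> t y = sqcell 0 1 -> t z = sqcell 1 0 ->
  t w = sqcell 1 1 ->
  column_stabilizer t =i
  [:: 1%g; tperm x z; tperm y w; (tperm x z * tperm y w)%g].
Proof.
move=> En tx ty tz tw; have N := uniq4_neq En.1.
(* Columns are numbered in ['I_4], since [cell] bounds them by the size of the partition, while rows
   live in ['I_2]. *)
have c01 : (inord 0 == inord 1 :> 'I_4) = false by rewrite -val_eqE /= !inordK.
have c10 : (inord 1 == inord 0 :> 'I_4) = false by rewrite eq_sym.
move=> s; rewrite !inE; apply/forallP/idP => [H|].
  have Hx := H x; have Hy := H y; have Hz := H z; have Hw := H w.
  have sx : s x \in [:: x; z].
    move: Hx (En.2 (s x)); rewrite !inE => + /or4P[]/eqP e; rewrite e ?eqxx ?orbT //;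
    by rewrite tx ?ty ?tw /= c10.
  have sz : s z \in [:: x; z].
    move: Hz (En.2 (s z)); rewrite !inE => + /or4P[]/eqP e; rewrite e ?eqxx ?orbT //;
    by rewrite tz ?ty ?tw /= c10.
  have sy : s y \in [:: y; w].
    move: Hy (En.2 (s y)); rewrite !inE => + /or4P[]/eqP e; rewrite e ?eqxx ?orbT //;
    by rewrite ty ?tx ?tz /= c01.
  have sw : s w \in [:: y; w].
    move: Hw (En.2 (s w)); rewrite !inE => + /or4P[]/eqP e; rewrite e ?eqxx ?orbT //;
    by rewrite tw ?tx ?tz /= c01.
  have nxz : (s x == s z) = false by rewrite (inj_eq perm_inj) N.
  have nyw : (s y == s w) = false by rewrite (inj_eq perm_inj) N.
  move: sx sz sy sw; rewrite !inE.
  move=> /orP[]/eqP ex /orP[]/eqP ez /orP[]/eqP ey /orP[]/eqP ew;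
    move: nxz nyw; rewrite ?ex ?ey ?ez ?ew ?eqxx // => _ _.
  - have -> : s = 1%g; last by rewrite eqxx.
    by apply: (enumerates_permP En); rewrite perm1.
  - have -> : s = tperm y w; last by rewrite eqxx !orbT.
    by apply: (enumerates_permP En); rewrite tperm_if !(N, eqxx).
  - have -> : s = tperm x z; last by rewrite eqxx !orbT.
    by apply: (enumerates_permP En); rewrite tperm_if !(N, eqxx).
  have -> : s = (tperm x z * tperm y w)%g; last by rewrite eqxx !orbT.
  by apply: (enumerates_permP En); rewrite permM !(tperm_if, N, eqxx).
move=> /or4P[]/eqP -> u; have := En.2 u; rewrite !inE => /or4P[]/eqP ->;
  by rewrite ?permM ?perm1 !(tperm_if, N, eqxx) /= ?tx ?ty ?tz ?tw.
Qed.

Lemma eq_tabloid_ofE (t : {ffun T -> cell sq}) psi x y z w :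
  enumerates x y z w ->
  (psi == tabloid_of t) =
  [&& psi x == (t x).1, psi y == (t y).1, psi z == (t z).1 & psi w == (t w).1].
Proof.
move=> En; apply/eqP/and4P => [->|[/eqP ex /eqP ey /eqP ez /eqP ew]].
  by rewrite !ffunE !eqxx.
apply/ffunP => u; rewrite ffunE; have := En.2 u; rewrite !inE.
by move=> /or4P[]/eqP->.
Qed.

(** The identity and the double column swap are even and give the two tabloids of xy|zw; the single
    swaps are odd and give those of xw|zy. *)
Lemma polytabloid_square (t : {ffun T -> cell sq}) x y z w :
  enumerates x y z w ->
  t x = sqcell 0 0 -> t y = sqcell 0 1 -> t z = sqcell 1 0 ->
  t w = sqcell 1 1 ->
  polytabloid R t = pairing x y z w - pairing x w z y.
Proof.
move=> En tx ty tz tw; have N := uniq4_neq En.1.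
rewrite /polytabloid (eq_bigl _ _ (column_stabilizer_square En tx ty tz tw)).
rewrite -big_uniq; last first.
  (* The four column permutations are told apart by the images of [x] and [y]. *)
  apply: (@map_uniq _ _ (fun s : {perm T} => (s x, s y))).
  by rewrite /= !inE !xpair_eqE !permM !perm1 !(tperm_if, N, eqxx).
rewrite !big_cons big_nil odd_permM !odd_tperm !odd_perm1 !N /=.
apply/ffunP => psi; rewrite !ffunE !(eq_tabloid_ofE _ _ En) !ffunE.
rewrite !permM !perm1 !(tperm_if, N, eqxx) tx ty tz tw /= !expr1 !expr0.
have i2 (i : 'I_2) : i = inord 0 \/ i = inord 1.
  by case: i => -[|[|]] // h; [left|right]; apply/val_inj; rewrite /= inordK.
have i01 : (inord 0 == inord 1 :> 'I_2) = false by rewrite -val_eqE /= !inordK.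
have i10 : (inord 1 == inord 0 :> 'I_2) = false by rewrite eq_sym.
case: (i2 (psi x)) => ->; case: (i2 (psi y)) => ->; case: (i2 (psi z)) => ->;
  case: (i2 (psi w)) => ->; rewrite !(eqxx, i01, i10) /=.
all: rewrite ?expr0 ?expr1 ?scaler0 ?scale1r ?scaleN1r.
all: by rewrite ?addr0 ?add0r ?subr0 ?sub0r ?oppr0.
Qed.

Lemma square_tableauP (t : {ffun T -> cell sq}) : is_tableau t ->
  exists x y z w, enumerates x y z w /\
    [/\ t x = sqcell 0 0, t y = sqcell 0 1, t z = sqcell 1 0
       & t w = sqcell 1 1].
Proof.
move=> /andP[/injectiveP tinj /eqP im].
have ex i j : (i < 2)%N -> (j < 2)%N -> exists u, t u = sqcell i j.
  move=> i2 j2; suff : sqcell i j \in diagram sq.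
    by rewrite -im => /imsetP[u _ ->]; exists u.
  by rewrite inE /= !inordK ?(leq_trans j2) //; case: i i2 => [|[]].
have [[x tx] [y ty]] := (ex 0 0 isT isT, ex 0 1 isT isT)%N.
have [[z tz] [w tw]] := (ex 1 0 isT isT, ex 1 1 isT isT)%N.
exists x, y, z, w; split=> //; split.
  apply: (@map_uniq _ _ t); rewrite /= tx ty tz tw.
  by rewrite !inE !xpair_eqE -!val_eqE /= !inordK.
move=> u; have : t u \in diagram sq by rewrite -im imset_f.
have -> : (u \in [:: x; y; z; w]) = (t u \in map t [:: x; y; z; w]).
  by rewrite mem_map.
rewrite /= tx ty tz tw inE !inE; case: (t u) => -[[|[|]] // i] [[|[|[|[|]]]] // j] _;
  by rewrite !xpair_eqE -!val_eqE /= !inordK.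
Qed.

Lemma square_tableau_exists x y z w : enumerates x y z w ->
  exists2 t : {ffun T -> cell sq}, is_tableau t &
    [/\ t x = sqcell 0 0, t y = sqcell 0 1, t z = sqcell 1 0
       & t w = sqcell 1 1].
Proof.
move=> En; have N := uniq4_neq En.1.
pose t := [ffun u => if u == x then sqcell 0 0 else if u == y then sqcell 0 1
  else if u == z then sqcell 1 0 else sqcell 1 1] : {ffun T -> cell sq}.
have [tx ty tz tw] : [/\ t x = sqcell 0 0, t y = sqcell 0 1, t z = sqcell 1 0
    & t w = sqcell 1 1] by rewrite !ffunE !(N, eqxx).
exists t => //; apply/andP; split.
  apply/injectiveP => u v; have := En.2 u; have := En.2 v; rewrite !inE.
  by move=> /or4P[]/eqP-> /or4P[]/eqP->; rewrite ?(tx, ty, tz, tw) //;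
    move=> /eqP; rewrite !xpair_eqE -!val_eqE /= !inordK.
apply/eqP/setP => -[i j]; rewrite inE; apply/imsetP/idP => [[u _ ->]|].
  have := En.2 u; rewrite !inE.
  by move=> /or4P[]/eqP->; rewrite ?(tx, ty, tz, tw) /= !inordK.
case: i j => [[|[|]] // i] [[|[|[|[|]]]] // j] _;
  [exists x|exists y|exists z|exists w] => //; rewrite ?(tx, ty, tz, tw);
  by apply/eqP; rewrite xpair_eqE -!val_eqE /= !inordK.
Qed.

(** These are the seven nontrivial elements of the dihedral group of order 8 that preserves the
    pairing xy|zw. *)
Lemma pairing_sym x y z w :
  (pairing y x z w = pairing x y z w) * (pairing x y w z = pairing x y z w) *
  (pairing y x w z = pairing x y z w) * (pairing z w x y = pairing x y z w) *
  (pairing w z x y = pairing x y z w) * (pairing z w y x = pairing x y z w) *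
  (pairing w z y x = pairing x y z w).
Proof.
by do !split; apply/ffunP => psi; rewrite !ffunE;
  do 4!case: (psi _) => [[|[|]] //= ?].
Qed.

End SquareShape.

Definition klein_four (T : finType) (a b c d : T) : seq {perm T} :=
  [:: 1%g; (tperm a b * tperm c d)%g; (tperm a c * tperm b d)%g;
      (tperm a d * tperm b c)%g].

(* Each 3-cycle is written as a product of two transpositions, the shape in which
   it occurs in the square of a combination of transpositions. *)
Definition three_cycles (T : finType) (a b c d : T) : seq {perm T} :=
  [:: (tperm a b * tperm b c)%g; (tperm b a * tperm a c)%g;
      (tperm a b * tperm b d)%g; (tperm b a * tperm a d)%g;
      (tperm a c * tperm c d)%g; (tperm c a * tperm a d)%g;
      (tperm b c * tperm c d)%g; (tperm c b * tperm b d)%g].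

Section Enumeration.
Variables (R : realType) (T : finType).
Notation sq := [:: 2; 2]%N.
Implicit Types (x y z w u : T) (s : {perm T}) (psi : tabloid T sq).
Local Notation pairing := (@pairing R T).
Variables a b c d : T.
Hypothesis En : enumerates a b c d.
Let N := uniq4_neq En.1.

(** The differences of ab|cd and of ac|bd from the third pairing ad|bc. *)
Let basis (j : bool) : tabloid_space R T sq :=
  (if j then pairing a b c d else pairing a c b d) - pairing a d b c.

(** A tabloid occurring in ab|cd (resp. ac|bd) and in no other pairing, so that evaluation there is
    dual to [basis]. *)
Let point (j : bool) : tabloid T sq :=
  [ffun u => if u \in [:: a; if j then b else c] then ord0 else ord_max].

Let basis_specht j s : tabloid_act s (basis j) \in specht R T sq.
Proof.
rewrite linearB /=.
have im x y z w : enumerates x y z w -> enumerates (s x) (s y) (s z) (s w).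
  move=> [U E]; split; first by rewrite -(map_inj_uniq (@perm_inj _ s)) in U.
  by move=> u; rewrite -(permKV s u) (mem_map (@perm_inj _ s) [:: x; y; z; w]).
have gen x y z w : enumerates x y z w ->
    pairing x y z w - pairing x w z y \in specht R T sq.
  move=> E; have [t t_tab [tx ty tz tw]] := square_tableau_exists E.
  rewrite -(polytabloid_square R E tx ty tz tw); apply: memv_span.
  by apply: map_f; rewrite mem_enum.
case: j; rewrite !tabloid_act_pairing.
  have -> : pairing (s a) (s d) (s b) (s c) = pairing (s a) (s d) (s c) (s b).
    by rewrite (pairing_sym R (s a) (s d) (s c) (s b)).
  exact/gen/im.
apply/gen/im; split; first by rewrite /= !inE !N.
by move=> u; have := En.2 u; rewrite !inE; case/or4P=> ->; rewrite ?orbT.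
Qed.

Let phi (j : bool) : {linear tabloid_space R T sq -> R[i]^o} :=
  tabloid_eval (point j).

Let dual v : v \in specht R T sq -> v = \sum_j phi j v *: basis j.
Proof.
rewrite /specht; apply: (@dual_family_span _ _ _ _ basis phi) v.
move=> _ /mapP[t + ->]; rewrite mem_enum => /square_tableauP.
move=> [x [y [z [w [E [tx ty tz tw]]]]]].
rewrite (polytabloid_square R E tx ty tz tw) big_bool /phi /=.
rewrite /tabloid_eval /point !ffunE !inE.
(* In each of the 24 orderings the polytabloid is a difference of two of the three pairings, hence a
   combination of the two differences in [basis]. *)
case: {E tx ty tz tw} (arrangementP En.2 E.1);
  rewrite !(N, eqxx) /=;
  rewrite ?(pairing_sym R a b c d, pairing_sym R a c b d, pairing_sym R a d b c);
  rewrite /basis;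
  move: (pairing a b c d) (pairing a c b d) (pairing a d b c) => p q r.
all: rewrite ?subrr ?sub0r ?subr0 ?scale0r ?scale1r ?scaleN1r ?add0r ?addr0.
all: rewrite ?opprB //.
all: by [rewrite addrA subrK | rewrite [RHS]addrC addrA subrK].
Qed.

Let perm_eqE s h : (s == h) =
  [&& s a == h a, s b == h b, s c == h c & s d == h d].
Proof.
apply/eqP/and4P => [->|[]]; first by rewrite !eqxx.
by do 4!move=> /eqP ?; apply: (enumerates_permP En).
Qed.

(** The trace is read off [basis] in each of the 24 cases: 2 on the Klein four-group, -1 on
    3-cycles, and 0 on transpositions and 4-cycles, which lie in neither list. *)
Lemma specht_char_square s :
  specht_char R sq s = 2 * \sum_(h <- klein_four a b c d) (s == h)%:R
    - \sum_(h <- three_cycles a b c d) (s == h)%:R.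
Proof.
rewrite !big_cons !big_nil.
rewrite /specht_char (@trace_dual_family _ _ _ _ basis phi (tabloid_act s)) //;
  last first.
  by move=> j; apply: basis_specht.
rewrite big_bool /phi /= /tabloid_eval /basis !linearB /=.
rewrite !tabloid_act_pairing /point !ffunE !inE.
have sU : uniq [:: s a; s b; s c; s d].
  by rewrite (map_inj_uniq (@perm_inj _ s) [:: a; b; c; d]); case: En.
rewrite !perm_eqE !permM !perm1 !(tperm_if, N, eqxx).
by case: {sU} (arrangementP En.2 sU); rewrite !(N, eqxx) /=; ring.
Qed.

End Enumeration.

(** * Sums over tuples of distinct indices *)

Lemma cards4 (T : finType) (a b c d : T) :
  uniq [:: a; b; c; d] -> #|[set a; b; c; d]| = 4.
Proof.
move=> U; transitivity #|[:: a; b; c; d]|; last by rewrite (card_uniqP U).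
by apply: eq_card => z; rewrite !inE !orbA.
Qed.

Section DistinctSums.
Variables (T : finType) (V : nmodType).

(* The newest index heads the list, so that [cons_uniq] isolates the condition
   on it. *)
Definition sum2 (h : T -> T -> V) : V := \sum_a \sum_(b | uniq [:: b; a]) h a b.

Definition sum3 (h : T -> T -> T -> V) : V :=
  \sum_a \sum_b \sum_(c | uniq [:: c; b; a]) h a b c.

Definition sum4 (h : T -> T -> T -> T -> V) : V :=
  \sum_a \sum_b \sum_c \sum_(d | uniq [:: d; c; b; a]) h a b c d.

Lemma eq_sum2 h h' : (forall a b, h a b = h' a b) -> sum2 h = sum2 h'.
Proof. by move=> e; do 2!apply: eq_bigr => ? _. Qed.

Lemma eq_sum3 h h' :
  (forall a b c, uniq [:: a; b; c] -> h a b c = h' a b c) -> sum3 h = sum3 h'.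
Proof.
move=> e; do 3!apply: eq_bigr => ? ?; apply: e.
by rewrite -rev_uniq.
Qed.

Lemma eq_sum4 h h' :
  (forall a b c d, uniq [:: a; b; c; d] -> h a b c d = h' a b c d) ->
  sum4 h = sum4 h'.
Proof.
move=> e; do 4!apply: eq_bigr => ? ?; apply: e.
by rewrite -rev_uniq.
Qed.

Lemma sum2D h h' : sum2 (fun a b => h a b + h' a b) = sum2 h + sum2 h'.
Proof.
by rewrite -big_split; apply: eq_bigr => a _; rewrite -big_split.
Qed.

Lemma sum3D h h' :
  sum3 (fun a b c => h a b c + h' a b c) = sum3 h + sum3 h'.
Proof.
rewrite -big_split; apply: eq_bigr => a _; rewrite -big_split.
by apply: eq_bigr => b _; rewrite -big_split.
Qed.

Lemma sum4D h h' :
  sum4 (fun a b c d => h a b c d + h' a b c d) = sum4 h + sum4 h'.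
Proof.
rewrite -big_split; apply: eq_bigr => a _; rewrite -big_split.
apply: eq_bigr => b _; rewrite -big_split.
by apply: eq_bigr => c _; rewrite -big_split.
Qed.

(** Distinctness is a symmetric condition. The adjacent exchanges here and below compose to every
    relabelling of the summation indices. *)
Lemma sum3C12 h : sum3 h = sum3 (fun a b c => h b a c).
Proof.
rewrite /sum3 exchange_big; do 2!apply: eq_bigr => ? _; apply: eq_bigl => ?.
by apply/perm_uniq/seq.permP => p /=; lia.
Qed.

Lemma sum3C23 h : sum3 h = sum3 (fun a b c => h a c b).
Proof.
apply: eq_bigr => a _; rewrite (exchange_big_dep predT) //.
apply: eq_bigr => ? _; apply: eq_bigl => ?.
by rewrite andTb; apply/perm_uniq/seq.permP => p /=; lia.
Qed.

Lemma sum4C12 h : sum4 h = sum4 (fun a b c d => h b a c d).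
Proof.
rewrite /sum4 exchange_big; do 3!apply: eq_bigr => ? _; apply: eq_bigl => ?.
by apply/perm_uniq/seq.permP => p /=; lia.
Qed.

Lemma sum4C23 h : sum4 h = sum4 (fun a b c d => h a c b d).
Proof.
apply: eq_bigr => a _; rewrite exchange_big; do 2!apply: eq_bigr => ? _.
by apply: eq_bigl => ?; apply/perm_uniq/seq.permP => p /=; lia.
Qed.

Lemma sum4C34 h : sum4 h = sum4 (fun a b c d => h a b d c).
Proof.
do 2!apply: eq_bigr => ? _; rewrite (exchange_big_dep predT) //.
apply: eq_bigr => ? _; apply: eq_bigl => ?.
by rewrite andTb; apply/perm_uniq/seq.permP => p /=; lia.
Qed.

(** The pairs (c, d) are sorted by how they meet {a, b}: in both entries, in exactly one, or not at
    all. *)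
Lemma sum_offdiag_split a b (H : T -> T -> V) : b != a ->
  \sum_c \sum_(d | d != c) H c d = H a b + H b a
    + \sum_(d | d \notin [:: b; a]) (H a d + H d a + (H b d + H d b))
    + \sum_(c | c \notin [:: b; a]) \sum_(d | d \notin [:: c; b; a]) H c d.
Proof.
move=> ab.
have E (F : T -> V) :
  \sum_(c | c \notin [:: b; a]) F c = \sum_(c | (c != a) && (c != b)) F c.
  by apply: eq_bigl => c; rewrite !inE negb_or andbC.
have out (G : T -> V) :
    \sum_c G c = G a + (G b + \sum_(c | (c != a) && (c != b)) G c).
  by rewrite (bigD1 a) // (bigD1 b).
have ra : \sum_(d | d != a) H a d
    = H a b + \sum_(d | (d != a) && (d != b)) H a d by rewrite (bigD1 b).
have rb : \sum_(d | d != b) H b d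
    = H b a + \sum_(d | (d != a) && (d != b)) H b d.
  rewrite (bigD1 a) 1?eq_sym //; congr (_ + _).
  by apply: eq_bigl => d; rewrite andbC.
have rc c : (c != a) && (c != b) -> \sum_(d | d != c) H c d
    = H c a + (H c b + \sum_(d | d \notin [:: c; b; a]) H c d).
  move=> /andP[ca cb].
  rewrite (bigD1 a) 1?eq_sym // (bigD1 b) /=; last by rewrite ab eq_sym cb.
  congr (_ + (_ + _)); apply: eq_bigl => d; rewrite !inE !negb_or.
  by case: (d == a); case: (d == b); case: (d == c).
rewrite out ra rb (eq_bigr _ rc) !E !big_split.
(* Blocks 1 and 3 are the full overlaps, 2, 5, 4 and 6 the single ones, and 7 the pairs disjoint
   from {a, b}. *)
by rewrite [LHS](AC (2*(2*(1*2))) ((1*3)*((2*5)*(4*6))*7)).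
Qed.

(** Two off-diagonal pairs share no index, one index (in four ways), or both (in two ways). *)
Lemma sum_offdiag (h : T -> T -> T -> T -> V) :
  \sum_a \sum_(b | b != a) \sum_c \sum_(d | d != c) h a b c d =
  sum4 h + sum3 (fun a b c => h a b a c + h a b c a + (h a b b c + h a b c b))
  + sum2 (fun a b => h a b a b + h a b b a).
Proof.
transitivity (\sum_a \sum_(b | b != a) (
    \sum_c \sum_(d | uniq [:: d; c; b; a]) h a b c d +
    \sum_(c | uniq [:: c; b; a])
      (h a b a c + h a b c a + (h a b b c + h a b c b)) +
    (h a b a b + h a b b a))).
  apply: eq_bigr => a _; apply: eq_bigr => b ab.
  have u2 : uniq [:: b; a] by rewrite /= inE ab.
  rewrite (sum_offdiag_split _ ab) (AC 3 (3*2*1)); congr (_ + _ + _).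
    rewrite [LHS]big_mkcond; apply: eq_bigr => c _.
    have cu d : uniq [:: d; c; b; a]
        = (d \notin [:: c; b; a]) && (c \notin [:: b; a]).
      by rewrite cons_uniq cons_uniq u2 andbT.
    case: ifPn => cab; first by apply: eq_bigl => d; rewrite cu cab andbT.
    by rewrite big_pred0 // => d; rewrite cu (negbTE cab) andbF.
  by apply: eq_bigl => c; rewrite cons_uniq u2 andbT.
rewrite /sum4 /sum3 /sum2 -big_split -big_split; apply: eq_bigr => a _ /=.
rewrite big_split big_split /=; congr (_ + _ + _).
- rewrite [LHS]big_mkcond; apply: eq_bigr => b _; case: eqP => //= ->.
  rewrite big1 // => c _; rewrite big_pred0 // => d.
  by rewrite !inE eqxx !(andbF, andFb).
- rewrite [LHS]big_mkcond; apply: eq_bigr => b _; case: eqP => //= ->.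
  by rewrite big_pred0 // => c; rewrite !inE eqxx !(andbF, andFb).
by apply: eq_bigl => b; rewrite inE andbT.
Qed.

(** Each four-element set is listed by 24 ordered quadruples. *)
Lemma sum_subsets4 (F : {set T} -> V) :
  (\sum_(X : {set T} | #|X| == 4) F X) *+ 24 =
  sum4 (fun a b c d => F [set a; b; c; d]).
Proof.
have cardD (A : {set T}) k a : #|A| = k.+1 -> a \in A -> #|A :\ a| = k.
  by move=> cA aA; move: (cardsD1 a A); rewrite cA aA => -[].
(* The factor 4 * 3 * 2 * 1 is spread over nested choices of elements of [X]; once the sums are
   exchanged, each quadruple of distinct indices determines [X]. *)
have const (X : {set T}) : #|X| == 4 -> F X *+ 24 =
    \sum_(a in X) \sum_(b in X :\ a) \sum_(c in X :\ a :\ b)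
      \sum_(d in X :\ a :\ b :\ c) F X.
  move=> /eqP cX; symmetry.
  rewrite (eq_bigr (fun=> F X *+ 6)) => [|a aX].
    by rewrite sumr_const cX -mulrnA.
  have ca := cardD _ _ _ cX aX; rewrite (eq_bigr (fun=> F X *+ 2)) => [|b bX].
    by rewrite sumr_const ca -mulrnA.
  have cb := cardD _ _ _ ca bX; rewrite (eq_bigr (fun=> F X)) => [|c cX'].
    by rewrite sumr_const cb.
  by rewrite sumr_const (cardD _ _ _ cb cX').
rewrite -sumrMnl (eq_bigr _ const) (exchange_big_dep predT) //.
apply: eq_bigr => a _; rewrite (exchange_big_dep predT) //.
apply: eq_bigr => b _; rewrite (exchange_big_dep predT) //.
apply: eq_bigr => c _; rewrite (exchange_big_dep predT) //.
rewrite [RHS]big_mkcond; apply: eq_bigr => d _.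
set u := uniq _; have uE : u = uniq [:: a; b; c; d] by rewrite -rev_uniq.
have P (X : {set T}) : [&& #|X| == 4, a \in X, b \in X :\ a, c \in X :\ a :\ b
    & d \in X :\ a :\ b :\ c] = u && (X == [set a; b; c; d]).
  rewrite uE; apply/idP/andP => [|[U /eqP->]].
    rewrite !in_setD1 => /and5P[cX aX /andP[ba bX] /and3P[cb ca cX']].
    case/and4P=> dc db da dX.
    have U : uniq [:: a; b; c; d].
      by rewrite -rev_uniq /= !inE !negb_or dc db da cb ca ba.
    split=> //; rewrite eq_sym eqEcard (eqP cX).
    rewrite (cards4 U) andbT; apply/subsetP => z; rewrite !inE -!orbA.
    by case/or4P=> /eqP->.
  have N := uniq4_neq U; rewrite !inE !(N, eqxx) ?orbT /= andbT.
  by rewrite (cards4 U).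
rewrite (eq_bigl _ _ (fun X => _ : _ = u && (X == [set a; b; c; d]))); last first.
  by move=> X; rewrite -P -!andbA.
by case: u {uE P}; [rewrite big_pred1_eq|rewrite big_pred0].
Qed.

End DistinctSums.

(** Both sides are the same 3-cycle, read from different starting letters; conjugating (a b) by (b
    c) gives (a c). *)
Lemma tperm_mul_rot (T : finType) (a b c : T) : uniq [:: a; b; c] ->
  (tperm a b * tperm b c)%g = (tperm b c * tperm c a)%g.
Proof.
rewrite /= !inE negb_or andbT => /andP[/andP[ab ac] bc].
rewrite conjgC tpermJ tpermL tpermD; first by rewrite (tpermC a c).
  by rewrite eq_sym.
by rewrite eq_sym.
Qed.

(** * The square of a sum of transpositions whose weights add up to zero *)

Section ZeroSum.
Variables (T : finType) (K : comNzRingType) (V : lmodType K).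
Variables (y : T -> K) (G : {perm T} -> V).
Hypothesis y0 : \sum_a y a = 0.

Lemma sum_notin (s : seq T) (w : K) (v : V) : uniq s ->
  \sum_(d | d \notin s) (w * y d) *: v = - ((w * \sum_(d <- s) y d) *: v).
Proof.
move=> U; rewrite -scaler_suml -mulr_sumr -scaleNr -mulrN; congr (_ * _ *: _).
apply/eqP; rewrite -addr_eq0 addrC big_uniq //.
by have := y0; rewrite (bigID (mem s)) => /eqP.
Qed.

(** An index that enters only through its weight can be summed out: as the weights have sum zero, it
    contributes minus the sum over the indices already taken. The next two lemmas do the same with
    fewer indices. *)
Lemma sum4_last (w : T -> T -> T -> K) (H : T -> T -> T -> V) :
  sum4 (fun a b c d => (w a b c * y d) *: H a b c)
  = - sum3 (fun a b c => (w a b c * (y a + y b + y c)) *: H a b c).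
Proof.
rewrite /sum3 -sumrN; apply: eq_bigr => a _.
rewrite -sumrN; apply: eq_bigr => b _; rewrite -sumrN [RHS]big_mkcond.
apply: eq_bigr => c _; case: ifPn => U.
  have -> : y a + y b + y c = \sum_(d <- [:: c; b; a]) y d.
    by rewrite !big_cons big_nil; ring.
  by rewrite -(sum_notin _ _ U); apply: eq_bigl => d; rewrite cons_uniq U andbT.
by rewrite big_pred0 // => d; rewrite cons_uniq (negbTE U) andbF.
Qed.

Lemma sum3_last (w : T -> T -> K) (H : T -> T -> V) :
  sum3 (fun a b c => (w a b * y c) *: H a b)
  = - sum2 (fun a b => (w a b * (y a + y b)) *: H a b).
Proof.
rewrite /sum2 -sumrN; apply: eq_bigr => a _; rewrite -sumrN [RHS]big_mkcond.
apply: eq_bigr => b _; case: ifPn => U.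
  have -> : y a + y b = \sum_(d <- [:: b; a]) y d.
    by rewrite !big_cons big_nil; ring.
  by rewrite -(sum_notin _ _ U); apply: eq_bigl => d; rewrite cons_uniq U andbT.
by rewrite big_pred0 // => d; rewrite cons_uniq (negbTE U) andbF.
Qed.

Lemma sum2_last (w : T -> K) (H : T -> V) :
  sum2 (fun a b => (w a * y b) *: H a) = - \sum_a (w a * y a) *: H a.
Proof.
rewrite -sumrN; apply: eq_bigr => a _.
have -> : y a = \sum_(d <- [:: a]) y d by rewrite big_seq1.
rewrite -sum_notin //; apply: eq_bigl => d.
by rewrite cons_uniq andbT.
Qed.

Let e := G 1%g.
Let p2 := \sum_a y a ^+ 2.
Let p4e := \sum_a y a ^+ 4 *: e.
Let S2e := sum2 (fun a b => (y a ^+ 2 * y b ^+ 2) *: e).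
Let S4e := sum4 (fun a b c d => (y a * y b * y c * y d) *: e).
Let S4dt :=
  sum4 (fun a b c d => (y a * y b * y c * y d) *: G (tperm a b * tperm c d)%g).
(** The index [d] is a spare one, present only in the weight; in [S3cyc] below, the index common to
    the two transpositions carries a squared weight instead. *)
Let S4cyc :=
  sum4 (fun a b c d => (y a * y b * y c * y d) *: G (tperm a b * tperm b c)%g).
Let S3cyc :=
  sum3 (fun a b c => (y a * y b ^+ 2 * y c) *: G (tperm a b * tperm b c)%g).

Definition tperm_sum : V := \sum_a \sum_b (y a * y b) *: G (tperm a b).

(** The square of [tperm_sum] in expanded form, since the module [V] carries no product. *)
Definition tperm_pair_sum : V := \sum_a \sum_b \sum_c \sum_d
  (y a * y b * y c * y d) *: G (tperm a b * tperm c d)%g.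

(** Summing out the spare index of [S4cyc] leaves the factor y_a + y_b + y_c. The three copies of
    [S3cyc] are relabelled by rotations, which put the square on each index in turn and fix the
    3-cycle. *)
Let S3cycE : S3cyc *+ 3 = - S4cyc.
Proof.
rewrite /S4cyc sum4_last opprK.
rewrite mulrS mulr2n {1}/S3cyc [X in _ + (X + _)]sum3C12 [X in _ + (X + _)]sum3C23.
rewrite [X in _ + (_ + X)]sum3C23 [X in _ + (_ + X)]sum3C12.
rewrite -!sum3D; apply: eq_sum3 => a b c U.
have Uc : uniq [:: c; a; b] by rewrite -(rot_uniq 1).
rewrite -(tperm_mul_rot U) (tperm_mul_rot Uc) -!scalerDl.
by congr (_ *: _); ring.
Qed.

(** A Newton-type identity, from summing out one index after another: the weights become -3 y_a^2
    y_b y_c, then 3 (y_a^3 y_b + y_a^2 y_b^2), and the sum of y_a^3 y_b over distinct indices is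
    minus the fourth power sum. *)
Let S4eE : S4e = S2e *+ 3 - p4e *+ 3.
Proof.
rewrite /S4e (sum4_last (fun a b c => y a * y b * y c) (fun _ _ _ => e)).
have -> : sum3 (fun a b c => (y a * y b * y c * (y a + y b + y c)) *: e)
    = sum3 (fun a b c => (y a ^+ 2 * y b * y c) *: e) *+ 3.
  rewrite mulrS mulr2n [X in _ + (X + _)]sum3C12.
  rewrite [X in _ + (_ + X)]sum3C12 [X in _ + (_ + X)]sum3C23.
  rewrite -!sum3D; apply: eq_sum3 => a b c _.
  by rewrite -!scalerDl; congr (_ *: _); ring.
rewrite (sum3_last (fun a b => y a ^+ 2 * y b) (fun _ _ => e)) mulNrn opprK.
rewrite -mulrnBl; congr (_ *+ _).
have -> : p4e = - sum2 (fun a b => (y a ^+ 3 * y b) *: e).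
  rewrite (sum2_last (fun a => y a ^+ 3) (fun _ => e)) opprK.
  by apply: eq_bigr => a _; rewrite -exprSr.
rewrite opprK -sum2D; apply: eq_sum2 => a b.
by rewrite -scalerDl; congr (_ *: _); ring.
Qed.

Let p2eE : p2 ^+ 2 *: e = S2e + p4e.
Proof.
rewrite expr2 mulr_suml scaler_suml -big_split; apply: eq_bigr => a _ /=.
rewrite mulr_sumr scaler_suml (bigD1 a) //= addrC -exprD; congr (_ + _).
by apply: eq_bigl => b; rewrite inE andbT.
Qed.

Let diagE : \sum_a \sum_(b | b != a) (y a * y b) *: G (tperm a b)
  = tperm_sum - p2 *: e.
Proof.
apply/eqP; rewrite eq_sym subr_eq; apply/eqP.
rewrite scaler_suml -big_split; apply: eq_bigr => a _ /=.
by rewrite (bigD1 a) //= addrC tperm1.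
Qed.

(** The terms with c = d and those with a = b are removed first, each giving [p2] times a sum of
    transpositions. In the rest, disjoint pairs give double transpositions, one shared index gives a
    3-cycle, and equal pairs give the identity. *)
Let pairE : tperm_pair_sum =
  S4dt + S3cyc *+ 4 + S2e *+ 2 + (p2 *+ 2) *: tperm_sum - p2 ^+ 2 *: e.
Proof.
pose f a b c d := (y a * y b * y c * y d) *: G (tperm a b * tperm c d)%g.
have step1 : tperm_pair_sum =
    p2 *: tperm_sum + \sum_a \sum_b \sum_c \sum_(d | d != c) f a b c d.
  rewrite scaler_sumr -big_split; apply: eq_bigr => a _ /=.
  rewrite scaler_sumr -big_split; apply: eq_bigr => b _ /=.
  rewrite scaler_suml -big_split; apply: eq_bigr => c _ /=.
  rewrite (bigD1 c) //= tperm1 mulg1 scalerA; congr (_ *: _ + _); ring.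
have step2 : \sum_a \sum_b \sum_c \sum_(d | d != c) f a b c d =
    p2 *: (tperm_sum - p2 *: e) +
    \sum_a \sum_(b | b != a) \sum_c \sum_(d | d != c) f a b c d.
  rewrite -diagE scaler_suml -big_split; apply: eq_bigr => a _ /=.
  rewrite (bigD1 a) //=; congr (_ + _).
  rewrite scaler_sumr; apply: eq_bigr => c _.
  rewrite scaler_sumr; apply: eq_bigr => d _.
  by rewrite /f tperm1 mul1g scalerA; congr (_ *: _); ring.
rewrite step1 step2 sum_offdiag.
have -> : sum3 (fun a b c => f a b a c + f a b c a + (f a b b c + f a b c b))
    = S3cyc *+ 4.
  have -> : S3cyc *+ 4 = S3cyc *+ 2 + S3cyc *+ 2 by rewrite -mulrnDr.
  rewrite sum3D; congr (_ + _).
    rewrite sum3C12 mulr2n -sum3D; apply: eq_sum3 => a b c _.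
    rewrite /f (tpermC b a) (tpermC c b).
    by congr (_ *: _ + _ *: _); ring.
  rewrite mulr2n -sum3D; apply: eq_sum3 => a b c _.
  by rewrite /f (tpermC c b); congr (_ *: _ + _ *: _); ring.
have -> : sum2 (fun a b => f a b a b + f a b b a) = S2e *+ 2.
  rewrite mulr2n -sum2D; apply: eq_sum2 => a b.
  by rewrite /f (tpermC b a) tperm2; congr (_ *: _ + _ *: _); ring.
rewrite scalerBr scalerA -expr2 addrA addrA [LHS]addrC mulr2n scalerDl.
by rewrite [LHS]addrA [LHS]addrC !addrA.
Qed.

Let klein_sum : sum4 (fun a b c d => (y a * y b * y c * y d) *:
    \sum_(h <- klein_four a b c d) G h) = S4e + S4dt *+ 3.
Proof.
have e2 : sum4 (fun a b c d =>
    (y a * y b * y c * y d) *: G (tperm a c * tperm b d)%g) = S4dt.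
  rewrite sum4C23; apply: eq_sum4 => a b c d _; congr (_ *: _); ring.
have e3 : sum4 (fun a b c d =>
    (y a * y b * y c * y d) *: G (tperm a d * tperm b c)%g) = S4dt.
  rewrite -e2 sum4C34; apply: eq_sum4 => a b c d _; congr (_ *: _); ring.
rewrite mulrS mulr2n -[X in _ + (_ + (X + _))]e2 -[X in _ + (_ + (_ + X))]e3.
rewrite -!sum4D; apply: eq_sum4 => a b c d _.
by rewrite !big_cons big_nil addr0 !scalerDr.
Qed.

(** The weight is symmetric, and each of the eight 3-cycles becomes (a b)(b c) after relabelling, so
    all contribute equally. *)
Let cycle_sum : sum4 (fun a b c d => (y a * y b * y c * y d) *:
    \sum_(h <- three_cycles a b c d) G h) = S4cyc *+ 8.
Proof.
pose C h := sum4 (fun a b c d => (y a * y b * y c * y d) *: G (h a b c d)).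
have e2 : C (fun a b c d => tperm b a * tperm a c)%g = S4cyc.
  rewrite /C sum4C12; apply: eq_sum4 => a b c d _; congr (_ *: _); ring.
have e3 : C (fun a b c d => tperm a b * tperm b d)%g = S4cyc.
  rewrite /C sum4C34; apply: eq_sum4 => a b c d _; congr (_ *: _); ring.
have e4 : C (fun a b c d => tperm b a * tperm a d)%g = S4cyc.
  rewrite -e2 /C sum4C34; apply: eq_sum4 => a b c d _; congr (_ *: _); ring.
have e5 : C (fun a b c d => tperm a c * tperm c d)%g = S4cyc.
  rewrite -e3 /C sum4C23; apply: eq_sum4 => a b c d _; congr (_ *: _); ring.
have e6 : C (fun a b c d => tperm c a * tperm a d)%g = S4cyc.
  rewrite -e4 /C sum4C23; apply: eq_sum4 => a b c d _; congr (_ *: _); ring.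
have e7 : C (fun a b c d => tperm b c * tperm c d)%g = S4cyc.
  rewrite -e5 /C sum4C12; apply: eq_sum4 => a b c d _; congr (_ *: _); ring.
have e8 : C (fun a b c d => tperm c b * tperm b d)%g = S4cyc.
  rewrite -e6 /C sum4C12; apply: eq_sum4 => a b c d _; congr (_ *: _); ring.
transitivity (S4cyc + (S4cyc + (S4cyc + (S4cyc + (S4cyc + (S4cyc + (S4cyc
  + S4cyc))))))); last by rewrite !mulrS mulr0n addr0.
rewrite -{2}e2 -{2}e3 -{2}e4 -{2}e5 -{2}e6 -{2}e7 -{2}e8.
rewrite -!sum4D; apply: eq_sum4 => a b c d _.
by rewrite !big_cons big_nil addr0 !scalerDr.
Qed.

(** By [pairE] and [p2eE] the bracket is [S4dt + S3cyc *+ 4 + (S2e - p4e)]. A factor 3 turns [S3cyc]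
    into [- S4cyc] and [S2e - p4e] into [S4e]; a further factor 2 matches the coefficients of the
    character. *)
Lemma tperm_pair_sumE :
  (tperm_pair_sum - (p2 *+ 2) *: tperm_sum) *+ 6 =
  sum4 (fun a b c d => (y a * y b * y c * y d) *:
    ((\sum_(h <- klein_four a b c d) G h) *+ 2
      - \sum_(h <- three_cycles a b c d) G h)).
Proof.
transitivity ((S4e + S4dt *+ 3) *+ 2 - S4cyc *+ 8).
  have -> : tperm_pair_sum - (p2 *+ 2) *: tperm_sum
      = S4dt + S3cyc *+ 4 + (S2e - p4e).
    rewrite pairE p2eE addrAC addrK -addrA; congr (_ + _).
    by rewrite mulr2n opprD addrA addrK.
  have -> : S4cyc = - (S3cyc *+ 3) by rewrite S3cycE opprK.
  have arith (p q r : V) :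
      (p + q *+ 4 + r) *+ 6 = (r *+ 3 + p *+ 3) *+ 2 + q *+ 3 *+ 8.
    by rewrite (mulrnDl 6) (mulrnDl 6 p) (mulrnDl 2) -!mulrnA addrC addrA.
  by rewrite S4eE mulNrn opprK -mulrnBl arith.
rewrite -klein_sum -cycle_sum mulr2n -sum4D.
have sum4N h : - sum4 h = sum4 (fun a b c d => - h a b c d) :> V.
  by rewrite /sum4; do 4!(rewrite -sumrN; apply: eq_bigr => ? _).
rewrite sum4N -sum4D; apply: eq_sum4 => a b c d _.
by rewrite scalerBr mulr2n scalerDr.
Qed.

End ZeroSum.

(** * The coordinate as a polynomial in transpositions *)

Section ExtendPerm.
Variables (n : nat) (X : {set 'I_n}).
Implicit Types (s t : {perm {a : 'I_n | a \in X}}).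

Lemma extend_permE s (b : {a : 'I_n | a \in X}) :
  extend_perm s (val b) = val (s b).
Proof. by rewrite permE /extend_fun valK. Qed.

Lemma extend_perm_out s a : a \notin X -> extend_perm s a = a.
Proof. by move=> Xa; rewrite permE /extend_fun insubN. Qed.

Lemma extend_perm1 : extend_perm (1%g : {perm {a : 'I_n | a \in X}}) = 1%g.
Proof.
apply/permP => a; rewrite perm1; have [Xa|] := boolP (a \in X).
  by rewrite (extend_permE 1%g (Sub a Xa)) perm1.
exact: extend_perm_out.
Qed.

Lemma extend_permM s t : extend_perm (s * t)%g = (extend_perm s * extend_perm t)%g.
Proof.
apply/permP => a; rewrite permM; have [Xa|Xa] := boolP (a \in X).
  by rewrite -[a]/(val (Sub a Xa : {a : 'I_n | a \in X})) !extend_permE permM.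
by rewrite !extend_perm_out.
Qed.

Lemma extend_perm_tperm (b c : {a : 'I_n | a \in X}) :
  extend_perm (tperm b c) = tperm (val b) (val c).
Proof.
apply/permP => a; have [Xa|Xa] := boolP (a \in X).
  rewrite -[a]/(val (Sub a Xa : {a : 'I_n | a \in X})) extend_permE !tperm_if.
  by rewrite !(inj_eq val_inj) !(fun_if val).
rewrite extend_perm_out // tpermD //; apply: contraNneq Xa => <-; exact: valP.
Qed.

(** The four letters enumerate the subtype of [X], and [extend_perm] is multiplicative and sends
    transpositions to transpositions, so it carries both lists of permutations over. *)
Lemma sum_specht_char_square (R : realType) (a b c d : 'I_n) :
  uniq [:: a; b; c; d] -> X = [set a; b; c; d] ->
  \sum_(s : {perm {a : 'I_n | a \in X}})
    specht_char R [:: 2; 2]%N s *: gelt R (extend_perm s) =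
  (\sum_(h <- klein_four a b c d) gelt R h) *+ 2
    - \sum_(h <- three_cycles a b c d) gelt R h.
Proof.
move=> U XE.
have mem z : (z \in X) = (z \in [:: a; b; c; d]) by rewrite XE !inE !orbA.
have [Xa Xb Xc Xd] : [/\ a \in X, b \in X, c \in X & d \in X].
  by split; rewrite mem !inE eqxx ?orbT.
pose S z Xz : {a : 'I_n | a \in X} := Sub z Xz.
have En : enumerates (S a Xa) (S b Xb) (S c Xc) (S d Xd).
  split; first by rewrite -(map_inj_uniq val_inj).
  by move=> u; rewrite -(mem_map val_inj) /= -mem; exact: valP.
have pick (r : seq {perm {a : 'I_n | a \in X}})
    (F : {perm {a : 'I_n | a \in X}} -> galg R n) :
    \sum_s (\sum_(h <- r) (s == h)%:R : R[i]) *: F s = \sum_(h <- r) F h.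
  under eq_bigr do rewrite scaler_suml.
  rewrite exchange_big; apply: eq_bigr => h _ /=.
  rewrite (bigD1 h) //= eqxx scale1r big1 ?addr0 // => s /negbTE->.
  by rewrite scale0r.
under eq_bigr => s _.
  rewrite (specht_char_square R En) scalerBl -scalerA scaler_nat.
  over.
rewrite big_split /= sumrN sumrMnl !pick !big_cons !big_nil.
by rewrite extend_perm1 !extend_permM !extend_perm_tperm.
Qed.

End ExtendPerm.

Section PluckerSquare.
Variables (R : realType) (n : nat) (y : 'I_n -> R[i]).
Hypothesis y_neq0 : forall a, y a != 0.
Hypothesis y_sum0 : \sum_a y a = 0.

Lemma plucker_square :
  plucker [:: 2; 2]%N (fun a => (y a)^-1) *+ 4 = (\prod_a (y a)^-1) *:
    (tperm_pair_sum y (@gelt R n)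
       - (\sum_a y a ^+ 2) *+ 2 *: tperm_sum y (@gelt R n)).
Proof.
set U := \prod_a (y a)^-1; set D := _ - _.
(* The product 4 * 6 is the number of orderings in [sum_subsets4], and the 6 on the right is that of
   [tperm_pair_sumE]. *)
suff : plucker [:: 2; 2]%N (fun a => (y a)^-1) *+ 4 *+ 6 = U *: D *+ 6.
  rewrite -[LHS]scaler_nat -[RHS]scaler_nat => /scalerI; apply.
  by rewrite pnatr_eq0.
rewrite [U *: D *+ 6]scalerMnr tperm_pair_sumE // -mulrnA.
(* The product of the inverses over the complement of [X] is [U] times the product of the [y a] over
   [X]. *)
have -> : plucker [:: 2; 2]%N (fun a => (y a)^-1) = U *:
    \sum_(X : {set 'I_n} | #|X| == 4) (\prod_(a in X) y a) *:
      \sum_(s : {perm {a : 'I_n | a \in X}})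
        specht_char R [:: 2; 2]%N s *: gelt R (extend_perm s).
  rewrite scaler_sumr; apply: eq_bigr => X _; rewrite scalerA; congr (_ *: _).
  rewrite [U](bigID (mem X)) /= [RHS]mulrC mulrA -big_split.
  rewrite [X in X * _]big1 /= => [|a _]; last by rewrite mulfV.
  by rewrite mul1r; apply: eq_bigl => a; rewrite inE.
rewrite scalerMnr sum_subsets4; congr (_ *: _).
apply: eq_sum4 => a b c d U4; congr (_ *: _); last exact: sum_specht_char_square.
transitivity (\prod_(i <- [:: a; b; c; d]) y i).
  by rewrite big_uniq //=; apply: eq_bigl => i; rewrite !inE !orbA.
by rewrite !big_cons big_nil mulr1 !mulrA.
Qed.

End PluckerSquare.

(** * Positive semidefinite matrices and the operator norm *)

Section HermitianMatrices.
Variables (R : realType) (d : nat).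
Implicit Types (A B M : 'M[R[i]]_d) (u v : 'rV[R[i]]_d).

Lemma hermsymmxP A : reflect (map_mx Num.conj A^T = A) (A \is hermsymmx).
Proof. by rewrite is_hermitianmxE expr0 scale1r; apply: (iffP eqP). Qed.

Lemma dotmx_mulmxr A u v :
  dotmx (u *m A) v = dotmx u (v *m map_mx Num.conj A^T).
Proof.
rewrite !dotmxE trmx_mul map_mxM -mulmxA; congr ((_ *m (_ *m _)) 0 0).
apply/matrixP => i j; rewrite !mxE; exact: esym (conjCK _).
Qed.

Lemma dotmxZl (a : R[i]) u v : dotmx (a *: u) v = a * dotmx u v.
Proof. exact: linearZl_LR. Qed.

Lemma dotmxDl u1 u2 v : dotmx (u1 + u2) v = dotmx u1 v + dotmx u2 v.
Proof. exact: linearDl. Qed.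

Lemma dotmxBl u1 u2 v : dotmx (u1 - u2) v = dotmx u1 v - dotmx u2 v.
Proof. exact: linearBl. Qed.

Lemma dotmx_herm A u v :
  A \is hermsymmx -> dotmx (u *m A) v = dotmx u (v *m A).
Proof. by move=> /hermsymmxP hA; rewrite dotmx_mulmxr hA. Qed.

Lemma hermsymmxD A B :
  A \is hermsymmx -> B \is hermsymmx -> A + B \is hermsymmx.
Proof.
by move=> /hermsymmxP hA /hermsymmxP hB; apply/hermsymmxP;
  rewrite linearD map_mxD hA hB.
Qed.

Lemma hermsymmxZ (c : R) A : A \is hermsymmx -> c%:C *: A \is hermsymmx.
Proof.
move=> /hermsymmxP hA; apply/hermsymmxP.
by rewrite linearZ map_mxZ hA; congr (_ *: _); apply: conjc_real.
Qed.

Lemma hermsymmxM A B : A \is hermsymmx -> B \is hermsymmx ->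
  A *m B = B *m A -> A *m B \is hermsymmx.
Proof.
by move=> /hermsymmxP hA /hermsymmxP hB AB; apply/hermsymmxP;
  rewrite trmx_mul map_mxM hA hB.
Qed.

Lemma hermsymmx1 : (1%:M : 'M[R[i]]_d) \is hermsymmx.
Proof. exact: hermitian1mx_subproof. Qed.

Lemma psdmxD A B : psdmx A -> psdmx B -> psdmx (A + B).
Proof.
move=> [hA pA] [hB pB]; split=> [|v]; first exact: hermsymmxD.
rewrite mulmxDr dotmxDl; exact: addr_ge0 (pA v) (pB v).
Qed.

Lemma psdmxZ (c : R) A : 0 <= c -> psdmx A -> psdmx (c%:C *: A).
Proof.
move=> c0 [hA pA]; split=> [|v]; first exact: hermsymmxZ.
rewrite -scalemxAr dotmxZl; apply: mulr_ge0; [by rewrite ler0c|exact: pA].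
Qed.

Lemma psdmxZ_inv (c : R) A : 0 < c -> psdmx (c%:C *: A) -> psdmx A.
Proof.
move=> c0.
move=> /(psdmxZ (ltW (_ : 0 < c^-1))); rewrite scalerA -rmorphM mulVf ?gt_eqF //.
by rewrite scale1r; apply; rewrite invr_gt0.
Qed.

Lemma psdmx_conj A B : A \is hermsymmx -> psdmx B -> psdmx (A *m B *m A).
Proof.
move=> hA [hB pB]; split=> [|v].
  apply/hermsymmxP; rewrite !trmx_mul !map_mxM !mulmxA.
  by move/hermsymmxP: hA => ->; move/hermsymmxP: hB => ->.
by rewrite !mulmxA dotmx_herm.
Qed.

Lemma psdmx_sqr A : A \is hermsymmx -> psdmx (A *m A).
Proof.
move=> hA; split=> [|v]; first exact: hermsymmxM.
by rewrite mulmxA dotmx_herm // dnorm_ge0.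
Qed.

Lemma psdmx_sub_sqr (w : R) M : 0 < w -> M \is hermsymmx ->
  psdmx (w%:C%:M - M) /\ psdmx (w%:C%:M + M) <->
  psdmx ((w ^+ 2)%:C%:M - M *m M).
Proof.
move=> w0 hM; set W : 'M_d := w%:C%:M.
have hW : W \is hermsymmx.
  by rewrite /W -scalemx1; apply/hermsymmxZ/hermsymmx1.
have hN : - M \is hermsymmx.
  by rewrite -scaleN1r -(rmorphN1 (real_complex R)); apply: hermsymmxZ.
have hB := hermsymmxD hW hN; have hD := hermsymmxD hW hM.
have WW : (w ^+ 2)%:C%:M = W *m W :> 'M_d by rewrite -scalar_mxM -rmorphM.
have Wc A : A *m W = W *m A by rewrite scalar_mxC.
have two0 : 0 < w *+ 2 by rewrite pmulrn_lgt0.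
have dbl A : (w *+ 2)%:C *: A = W *m A + W *m A.
  by rewrite mul_scalar_mx -scalerDl -rmorphD.
have comm : (W - M) *m (W + M) = W *m W - M *m M.
  by rewrite mulmxDr !mulmxBl (Wc M) addrA subrK.
have comm' : (W + M) *m (W - M) = W *m W - M *m M.
  by rewrite mulmxBr !mulmxDl (Wc M) opprD addrA addrK.
rewrite WW; split=> [[p1 p2]|p].
  apply: (psdmxZ_inv two0).
  (* The two outer factors [W - M] and [W + M] add up to [2 W], once the product [W *m W - M *m M]
     is pulled out of both terms. *)
  have -> : (w *+ 2)%:C *: (W *m W - M *m M) =
      (W - M) *m (W + M) *m (W - M) + (W + M) *m (W - M) *m (W + M).
    rewrite comm comm' -mulmxDr addrACA addNr addr0 dbl (mulmxDr (_ - _)).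
    by rewrite (Wc (_ - _)).
  exact: psdmxD (psdmx_conj hB p2) (psdmx_conj hD p1).
split; apply: (psdmxZ_inv two0).
  have -> : (w *+ 2)%:C *: (W - M) = (W - M) *m (W - M) + (W *m W - M *m M).
    rewrite -comm -mulmxDr addrACA addNr addr0 dbl (mulmxDr (_ - _)).
    by rewrite (Wc (_ - _)).
  exact: psdmxD (psdmx_sqr hB) p.
have -> : (w *+ 2)%:C *: (W + M) = (W + M) *m (W + M) + (W *m W - M *m M).
  rewrite -comm' -mulmxDr addrACA addrN addr0 dbl (mulmxDr (_ + _)).
  by rewrite (Wc (_ + _)).
exact: psdmxD (psdmx_sqr hD) p.
Qed.

Lemma dotmx_l2norm v : dotmx v v = (l2norm v ^+ 2)%:C.
Proof.
have v0 : 0 <= dotmx v v by apply: dnorm_ge0.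
have Rv : (complex.Re (dotmx v v))%:C = dotmx v v by rewrite RRe_real ?ger0_real.
by rewrite sqr_sqrtr ?Rv // -ler0c Rv.
Qed.

Lemma l2norm_ge0 v : 0 <= l2norm v.
Proof. exact: sqrtr_ge0. Qed.

Lemma l2norm_eq0 v : (l2norm v == 0) = (v == 0).
Proof.
have e : (dotmx v v == 0) = (v == 0) := dnorm_eq0 _ v.
by rewrite -e dotmx_l2norm (fmorph_eq0 (real_complex R)) sqrf_eq0.
Qed.

Lemma l2normZ (c : R) v : 0 <= c -> l2norm (c%:C *: v) = c * l2norm v.
Proof.
move=> c0; apply/eqP; rewrite -(@eqrXn2 _ 2) ?mulr_ge0 ?l2norm_ge0 //.
apply/eqP/(@complexI R); rewrite -dotmx_l2norm exprMn rmorphM /= -dotmx_l2norm.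
rewrite dotmxZl linearZr_LR /= mulrA expr2 rmorphM; congr (_ * _ * _).
exact: conjc_real.
Qed.

(** As [M] is hermitian, the quadratic form at [v] is w^2 |v|^2 - |v M|^2. *)
Lemma psdmx_l2norm (w : R) M : 0 <= w -> M \is hermsymmx ->
  psdmx ((w ^+ 2)%:C%:M - M *m M) <->
  forall v, l2norm (v *m M) <= w * l2norm v.
Proof.
move=> w0 hM.
have E v : dotmx (v *m ((w ^+ 2)%:C%:M - M *m M)) v
         = ((w * l2norm v) ^+ 2 - l2norm (v *m M) ^+ 2)%:C.
  rewrite mulmxBr dotmxBl mulmxA [X in _ - X]dotmx_herm // !dotmx_l2norm.
  by rewrite mul_mx_scalar dotmxZl dotmx_l2norm -rmorphM -rmorphB exprMn.
have iffE v : (0 <= dotmx (v *m ((w ^+ 2)%:C%:M - M *m M)) v)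
            = (l2norm (v *m M) <= w * l2norm v).
  by rewrite E ler0c subr_ge0 ler_pXn2r ?nnegrE ?mulr_ge0 ?l2norm_ge0.
split=> [[_ p] v|p]; first by rewrite -iffE.
split=> [|v]; last by rewrite iffE.
apply: hermsymmxD.
  by rewrite -scalemx1; apply/hermsymmxZ/hermsymmx1.
rewrite -scaleN1r -(rmorphN1 (real_complex R)); apply: hermsymmxZ.
exact: hermsymmxM.
Qed.

Lemma l2norm_sqr v : ((l2norm v) ^+ 2)%:C = \sum_j `|v 0 j| ^+ 2.
Proof.
rewrite -dotmx_l2norm dotmxE mxE; apply: eq_bigr => j _.
by rewrite !mxE normCK.
Qed.

(** Makes the set in [opnorm] bounded, so that its [sup] is a genuine least upper bound. Entries of
    a vector in the unit ball have modulus at most 1, so absolute column sums give a bound. *)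
Lemma l2norm_mulmx_bounded M :
  exists K : R, forall v, l2norm v <= 1 -> l2norm (v *m M) <= K.
Proof.
pose s : R[i] := \sum_j (\sum_i `|M i j|) ^+ 2.
have s0 : 0 <= s by apply: sumr_ge0 => j _; rewrite exprn_ge0 // sumr_ge0.
exists (Num.sqrt (complex.Re s)) => v v1.
have sE : (complex.Re s)%:C = s by rewrite RRe_real ?ger0_real.
have s0' : 0 <= complex.Re s by rewrite -ler0c sE.
rewrite -(@ler_pXn2r _ 2) ?nnegrE ?l2norm_ge0 ?sqrtr_ge0 //.
rewrite (sqr_sqrtr s0') -lecR sE l2norm_sqr; apply: ler_sum => j _.
have vi i : `|v 0 i| <= 1.
  rewrite -(@ler_pXn2r _ 2) ?nnegrE // expr1n.
  apply: (@le_trans _ _ ((l2norm v) ^+ 2)%:C); last first.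
    by rewrite -[1]/(1%:C) lecR expr_le1 ?l2norm_ge0.
  rewrite l2norm_sqr (bigD1 i) //= lerDl sumr_ge0 // => k _.
  by rewrite exprn_ge0.
rewrite ler_pXn2r ?nnegrE ?sumr_ge0 // mxE.
apply: le_trans (ler_norm_sum _ _ _) _; apply: ler_sum => i _.
by rewrite normrM ler_piMl.
Qed.

(** By homogeneity: a nonzero vector is rescaled to norm 1, where the supremum bounds its image. *)
Lemma opnorm_leP (w : R) M : 0 <= w ->
  opnorm M <= w <-> forall v, l2norm (v *m M) <= w * l2norm v.
Proof.
move=> w0; have l0 : l2norm (0 : 'rV[R[i]]_d) = 0.
  by apply/eqP; rewrite l2norm_eq0.
split=> [op v|le]; last first.
  apply: ge_sup; first by exists (l2norm (0 *m M)); exists 0 => //=; rewrite l0.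
  move=> _ [v /= v1 <-]; apply: le_trans (le v) _.
  by rewrite ler_piMr.
have [/eqP v0|v0] := boolP (v == 0).
  by rewrite v0 mul0mx l0 mulr0.
have n0 : 0 < l2norm v by rewrite lt_def l2norm_eq0 v0 l2norm_ge0.
have [K leK] := l2norm_mulmx_bounded M.
suff : l2norm ((l2norm v)^-1%:C *: v *m M) <= w.
  rewrite -scalemxAl l2normZ ?invr_ge0 ?l2norm_ge0 //.
  by rewrite ler_pdivrMl // mulrC.
apply: le_trans op; apply: ub_le_sup.
  by exists K => _ [u /= u1 <-]; apply: leK.
exists ((l2norm v)^-1%:C *: v) => //=.
by rewrite l2normZ ?invr_ge0 ?l2norm_ge0 // mulVf // gt_eqF.
Qed.

End HermitianMatrices.

(** * Representations of the group algebra *)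

Section GroupAlgebra.
Variables (R : realType) (n : nat).
Implicit Types (A B : galg R n) (s t : 'S_n).

Lemma gstar_gelt s : gstar (gelt R s) = gelt R s^-1%g.
Proof.
apply/ffunP => t; rewrite !ffunE -(inj_eq invg_inj) invgK.
exact: conjc_nat.
Qed.

Lemma gstarD A B : gstar (A + B) = gstar A + gstar B.
Proof. by apply/ffunP => s; rewrite !ffunE; exact: rmorphD. Qed.

Lemma gstarZ (c : R) A : gstar (c%:C *: A) = c%:C *: gstar A.
Proof.
apply/ffunP => s; rewrite !ffunE -[in RHS](conjc_real c); exact: rmorphM.
Qed.

Lemma gstarN A : gstar (- A) = - gstar A.
Proof. by apply/ffunP => s; rewrite !ffunE; exact: rmorphN. Qed.

Lemma gstar_sum (I : finType) (P : pred I) (F : I -> galg R n) :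
  gstar (\sum_(i | P i) F i) = \sum_(i | P i) gstar (F i).
Proof.
apply: big_morph => [A B|]; first exact: gstarD.
by apply/ffunP => s; rewrite !ffunE; exact: conjc0.
Qed.

Lemma gself_adjoint_tperm_sum (y : 'I_n -> R) :
  gself_adjoint (tperm_sum (fun a => (y a)%:C) (@gelt R n)).
Proof.
rewrite /gself_adjoint gstar_sum; apply: eq_bigr => a _.
rewrite gstar_sum; apply: eq_bigr => b _.
by rewrite -rmorphM gstarZ gstar_gelt tpermV.
Qed.

(** The involution reverses (a b)(c d), and exchanging the two pairs of summation indices undoes
    this. *)
Lemma gself_adjoint_tperm_pair_sum (y : 'I_n -> R) :
  gself_adjoint (tperm_pair_sum (fun a => (y a)%:C) (@gelt R n)).
Proof.
rewrite /gself_adjoint /tperm_pair_sum.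
under [RHS]eq_bigr do rewrite exchange_big.
rewrite [RHS]exchange_big gstar_sum; apply: eq_bigr => a _ /=.
under [RHS]eq_bigr do rewrite exchange_big.
rewrite [RHS]exchange_big gstar_sum; apply: eq_bigr => b _ /=.
rewrite gstar_sum; apply: eq_bigr => c _; rewrite gstar_sum.
apply: eq_bigr => d _; rewrite -!rmorphM gstarZ gstar_gelt invMg !tpermV.
by congr (_%:C *: _); ring.
Qed.

Section Representation.
Variables (d : nat) (rG : mx_representation R[i] [set: 'S_n] d).

Lemma galg_repr_is_linear : linear (galg_repr rG).
Proof.
move=> c A B; rewrite /galg_repr scaler_sumr -big_split.
by apply: eq_bigr => s _; rewrite !ffunE scalerDl scalerA.
Qed.

HB.instance Definition _ :=
  GRing.isLinear.Build _ _ _ _ (galg_repr rG) galg_repr_is_linear.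

Lemma galg_repr_gelt s : galg_repr rG (gelt R s) = rG s.
Proof.
rewrite /galg_repr (bigD1 s) //= ffunE eqxx scale1r big1 ?addr0 // => t.
by move=> /negbTE ts; rewrite ffunE ts scale0r.
Qed.

(** Unitarity makes the adjoint of [rG s] equal to [rG s^-1], so the adjoint of the image is the
    image of [gstar A], after reindexing by inversion. *)
Lemma galg_repr_herm A : unitary_repr rG -> gself_adjoint A ->
  galg_repr rG A \is hermsymmx.
Proof.
move=> uG /ffunP hA; apply/hermsymmxP; rewrite /galg_repr.
rewrite raddf_sum /= map_mx_sum [RHS](reindex_inj invg_inj) /=.
apply: eq_bigr => s _; rewrite linearZ map_mxZ /=.
have := hA s; rewrite ffunE => <-.
have -> : map_mx Num.conj (rG s)^T = rG s^-1%g.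
  by rewrite -(invmx_unitary (uG s)) repr_mxV ?inE.
by congr (_ *: _); exact: conjcK.
Qed.

(** Here the expanded fourfold sum becomes an actual square, as a matrix. *)
Lemma galg_repr_tperm_pair_sum (y : 'I_n -> R[i]) :
  galg_repr rG (tperm_pair_sum y (@gelt R n)) =
  galg_repr rG (tperm_sum y (@gelt R n)) *m galg_repr rG (tperm_sum y (@gelt R n)).
Proof.
have -> : galg_repr rG (tperm_sum y (@gelt R n))
    = \sum_a \sum_b (y a * y b) *: rG (tperm a b).
  rewrite linear_sum; apply: eq_bigr => a _; rewrite linear_sum.
  by apply: eq_bigr => b _; rewrite linearZ /= galg_repr_gelt.
rewrite linear_sum mulmx_suml; apply: eq_bigr => a _.
rewrite linear_sum mulmx_suml; apply: eq_bigr => b _.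
rewrite linear_sum mulmx_sumr; apply: eq_bigr => c _.
rewrite linear_sum mulmx_sumr; apply: eq_bigr => d' _.
rewrite linearZ /= galg_repr_gelt repr_mxM ?inE //.
by rewrite -scalemxAl -scalemxAr scalerA mulrA.
Qed.

End Representation.
End GroupAlgebra.

(** * The element T *)

Lemma sum_symmetric (m : nat) (V : nmodType) (f : 'I_m -> 'I_m -> V) :
  (forall i j, f i j = f j i) ->
  \sum_i \sum_j f i j =
  \sum_i f i i + (\sum_(i < m) \sum_(j < m | (i < j)%N) f i j) *+ 2.
Proof.
move=> fC; rewrite mulr2n -[X in _ = _ + (_ + X)](_ :
  \sum_(i < m) \sum_(j < m | (j < i)%N) f i j = _); last first.
  rewrite (exchange_big_dep predT) //=; apply: eq_bigr => i _.
  by apply: eq_bigr => j _.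
rewrite -!big_split; apply: eq_bigr => i _ /=.
rewrite (bigD1 i) //=; congr (_ + _).
rewrite (bigID (fun j : 'I_m => (i < j)%N)) /=; congr (_ + _).
  by apply: eq_bigl => j; rewrite andbC -val_eqE /= ltn_neqAle eq_sym andbAC andbb.
by apply: eq_bigl => j; rewrite -leqNgt ltn_neqAle.
Qed.

Section Data.
Variables (R : realType) (m : nat) (x : 'I_m -> R).

(* The inverse of [weight_u], as a real number. *)
Definition weight_y (a : 'I_m.+1) : R :=
  if unlift ord_max a is Some i then x i else - \sum_(i < m) x i.

Lemma weight_y_lift i : weight_y (lift ord_max i) = x i.
Proof. by rewrite /weight_y liftK. Qed.

Lemma weight_y_max : weight_y ord_max = - \sum_(i < m) x i.
Proof. by rewrite /weight_y unlift_none. Qed.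

Lemma weight_uE a : weight_u x a = (weight_y a)%:C^-1.
Proof.
rewrite /weight_u /weight_y; case: unlift => [i|].
  exact: (fmorphV (real_complex R)).
by rewrite -invrN; exact: (fmorphV (real_complex R)).
Qed.

Lemma sum_weight_y : \sum_a weight_y a = 0.
Proof.
rewrite (bigD1_ord ord_max) //= weight_y_max.
by under eq_bigr do rewrite weight_y_lift; rewrite addNr.
Qed.

Lemma sum_sqr : (\sum_i x i) ^+ 2 =
  \sum_i x i ^+ 2 + (\sum_(i < m) \sum_(j < m | (i < j)%N) x i * x j) *+ 2.
Proof.
rewrite expr2 mulr_suml; under eq_bigr do rewrite mulr_sumr.
by rewrite sum_symmetric // => i j; rewrite mulrC.
Qed.

Lemma sum_weight_y_sqr : \sum_a weight_y a ^+ 2 = omega x *+ 2.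
Proof.
rewrite (bigD1_ord ord_max) //= weight_y_max sqrrN sum_sqr.
under [X in _ + X]eq_bigr do rewrite weight_y_lift.
by rewrite /omega; ring.
Qed.

(** Let s be the sum of the x_i. Isolating the last index in both sums leaves s^2 times the
    identity, -2 s times the sum of the x_i (i n), and the double sum over i, j < n, whose diagonal
    adds x_i^2; and s^2 plus the sum of the x_i^2 is 2 omega. *)
Lemma tperm_sum_calT :
  tperm_sum (fun a => (weight_y a)%:C) (@gelt R m.+1)
    = (gomega x - calT x) *+ 2.
Proof.
pose s := \sum_i x i.
pose G a b := gelt R (tperm a b : 'S_m.+1).
have -> : tperm_sum (fun a => (weight_y a)%:C) (@gelt R m.+1) =
    (s ^+ 2)%:C *: gelt R 1%g
    - (s%:C *: \sum_(i < m) (x i)%:C *: G (lift ord_max i) ord_max) *+ 2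
    + \sum_(i < m) \sum_(j < m)
        (x i * x j)%:C *: G (lift ord_max i) (lift ord_max j).
  rewrite /tperm_sum (bigD1_ord ord_max) //= (bigD1_ord ord_max) //=.
  rewrite weight_y_max tperm1 -rmorphM mulrNN -expr2 -!addrA; congr (_ + _).
  have B (H : 'I_m -> galg R m.+1) :
      \sum_(i < m) ((- s)%:C * (weight_y (lift ord_max i))%:C) *: H i
      = - (s%:C *: \sum_(i < m) (x i)%:C *: H i).
    rewrite rmorphN -scaleNr scaler_sumr; apply: eq_bigr => i _.
    by rewrite weight_y_lift scalerA.
  rewrite (B (fun i => gelt R (tperm ord_max (lift ord_max i)))).
  have -> : \sum_(i < m) (x i)%:C *: gelt R (tperm ord_max (lift ord_max i))
      = \sum_(i < m) (x i)%:C *: G (lift ord_max i) ord_max.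
    by apply: eq_bigr => i _; rewrite /G tpermC.
  under [X in _ + X]eq_bigr => i _.
    rewrite (bigD1_ord ord_max) //= weight_y_max mulrC -/(G _ _).
    over.
  rewrite big_split /= (B (fun i => G (lift ord_max i) ord_max)).
  rewrite mulr2n opprD; move: (s%:C *: _) => Z; rewrite -addrA.
  do 2!congr (_ + _).
  apply: eq_bigr => i _; apply: eq_bigr => j _.
  by rewrite !weight_y_lift -rmorphM.
rewrite sum_symmetric => [|i j]; last by rewrite mulrC /G tpermC.
under [X in _ + (X + _)]eq_bigr do rewrite /G tperm1.
rewrite -scaler_suml -rmorph_sum /= addrACA -scalerDl -rmorphD.
have -> : s ^+ 2 + \sum_i x i * x i = omega x *+ 2.
  by rewrite sum_sqr /omega; under [X in _ + X]eq_bigr do rewrite -expr2; ring.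
rewrite rmorphMn -scalerMnl -mulNrn -mulrnDl -mulrnDl; congr (_ *+ _).
rewrite /gomega /calT opprB; congr (_ + _); exact: addrC.
Qed.

(** Replacing each transposition by [e] leaves [e] times the squared sum of the x_i minus the sum of
    the x_i x_j over i < j, which is [e * omega x]. *)
Lemma galg_repr_calT_scalar (d : nat)
    (rG : mx_representation R[i] [set: 'S_m.+1] d) (e : R) :
  (forall a b, a != b -> rG (tperm a b) = e%:C%:M) ->
  galg_repr rG (calT x) = (e * omega x)%:C%:M.
Proof.
move=> rGe.
have rT (c : R[i]) a b : a != b ->
    galg_repr rG (c *: gelt R (tperm a b)) = c *: e%:C%:M.
  by move=> ab; rewrite (linearZ_LR (galg_repr rG)) /= galg_repr_gelt rGe.
have -> : galg_repr rG (calT x) =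
    (\sum_i x i)%:C *: ((\sum_i x i)%:C *: e%:C%:M)
    - (\sum_(i < m) \sum_(j < m | (i < j)%N) x i * x j)%:C *: e%:C%:M.
  rewrite /calT (linearB (galg_repr rG)) /= (linearZ_LR (galg_repr rG)) /=.
  rewrite !(linear_sum (galg_repr rG)) /=; congr (_ *: _ - _).
    rewrite rmorph_sum scaler_suml; apply: eq_bigr => i _.
    by rewrite rT // eq_sym neq_lift.
  rewrite rmorph_sum scaler_suml; apply: eq_bigr => i _.
  rewrite (linear_sum (galg_repr rG)) rmorph_sum scaler_suml /=.
  apply: eq_bigr => j ij; rewrite rT //.
  by rewrite (inj_eq (@lift_inj _ _)) -val_eqE /= ltn_eqF.
rewrite scalerA -rmorphM -scalerBl -rmorphB scale_scalar_mx -rmorphM -expr2.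
by congr (_%:C%:M); rewrite sum_sqr /omega; ring.
Qed.

End Data.

(** * The equivalences for positive weights *)

Section Positivity.
Variables (R : realType) (m : nat) (x : 'I_m -> R).
Hypotheses (m_gt0 : (0 < m)%N) (x_gt0 : forall i, 0 < x i).

Lemma sum_x_gt0 : 0 < \sum_i x i.
Proof.
rewrite (bigD1 (Ordinal m_gt0)) //= ltr_pwDl // sumr_ge0 // => i _.
exact: ltW.
Qed.

Lemma omega_gt0 : 0 < omega x.
Proof.
rewrite /omega ltr_pwDl //; last first.
  by do 2!apply: sumr_ge0 => ? _; rewrite mulr_ge0 // ltW.
rewrite (bigD1 (Ordinal m_gt0)) //= ltr_pwDl ?exprn_gt0 // sumr_ge0 // => i _.
exact: sqr_ge0.
Qed.

Lemma weight_y_neq0 a : weight_y x a != 0.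
Proof.
rewrite /weight_y; case: unlift => [i|]; first exact: lt0r_neq0.
by rewrite oppr_eq0 lt0r_neq0 ?sum_x_gt0.
Qed.

(** Exactly one factor is negative, the one at [ord_max]. *)
Lemma prod_weight_y_lt0 : \prod_a (weight_y x a)^-1 < 0.
Proof.
rewrite (bigD1_ord ord_max) //= weight_y_max invrN mulNr oppr_lt0 mulr_gt0 //.
  by rewrite invr_gt0 sum_x_gt0.
by apply: prodr_gt0 => i _; rewrite weight_y_lift invr_gt0.
Qed.

Let y a : R[i] := (weight_y x a)%:C.
Let U := \prod_a (weight_y x a)^-1.
Let P := plucker [:: 2; 2]%N (weight_u x).

Lemma plucker_weight_u : P = (U / 4)%:C *:
  (tperm_pair_sum y (@gelt R _)
    - (omega x *+ 4)%:C *: tperm_sum y (@gelt R _)).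
Proof.
have UE : \prod_a (y a)^-1 = U%:C.
  by rewrite rmorph_prod; apply: eq_bigr => a _; rewrite -fmorphV.
have p2E : (\sum_a y a ^+ 2) *+ 2 = (omega x *+ 4)%:C.
  under eq_bigr do rewrite /y -rmorphXn.
  by rewrite -rmorph_sum sum_weight_y_sqr /= -rmorphMn -mulrnA.
have -> : P = plucker [:: 2; 2]%N (fun a => (y a)^-1).
  apply: eq_bigr => X _; congr (_ *: _).
  by apply: eq_bigr => a _; rewrite weight_uE.
have y_neq0 a : y a != 0 by rewrite (fmorph_eq0 (real_complex R)) weight_y_neq0.
have y_sum0 : \sum_a y a = 0.
  by rewrite -rmorph_sum sum_weight_y rmorph0.
apply: (@scalerI _ _ (4%:R)); first by rewrite pnatr_eq0.
rewrite scaler_nat (plucker_square y_neq0 y_sum0) UE p2E scalerA; congr (_ *: _).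
by rewrite rmorphM fmorphV rmorph_nat mulrC divfK // pnatr_eq0.
Qed.

Lemma gself_adjoint_plucker : gself_adjoint P.
Proof.
rewrite /gself_adjoint plucker_weight_u gstarZ gstarD gstarN gstarZ.
by rewrite gself_adjoint_tperm_sum gself_adjoint_tperm_pair_sum.
Qed.

Lemma gself_adjoint_gomega : gself_adjoint (gomega x).
Proof. by rewrite /gself_adjoint gstarZ gstar_gelt invg1. Qed.

Lemma gself_adjoint_calT : gself_adjoint (calT x).
Proof.
rewrite /gself_adjoint /calT; set A := (X in _ *: X - _); set B := (X in _ - X).
have hA : gstar A = A.
  by rewrite gstar_sum; apply: eq_bigr => i _; rewrite gstarZ gstar_gelt tpermV.
have hB : gstar B = B.
  rewrite gstar_sum; apply: eq_bigr => i _; rewrite gstar_sum.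
  by apply: eq_bigr => j _; rewrite gstarZ gstar_gelt tpermV.
by rewrite gstarD gstarN gstarZ hA hB.
Qed.

Section Representation.
Variables (d : nat) (rG : mx_representation R[i] [set: 'S_m.+1] d).
Let M := galg_repr rG (calT x).

Lemma galg_repr_gomega : galg_repr rG (gomega x) = (omega x)%:C%:M.
Proof. by rewrite linearZ /= galg_repr_gelt repr_mx1 scalemx1. Qed.

(** With Q = 2 (W - M), the expression Q^2 - 4 W Q equals 4 (W - M) (- W - M), that is, -4 (W^2 -
    M^2); the 4 cancels the denominator in [plucker_weight_u]. *)
Lemma galg_repr_plucker :
  galg_repr rG P = (- U)%:C *: ((omega x ^+ 2)%:C%:M - M *m M).
Proof.
pose W : 'M[R[i]]_d := (omega x)%:C%:M.
have QE : galg_repr rG (tperm_sum y (@gelt R _)) = (W - M) *+ 2.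
  rewrite tperm_sum_calT mulr2n linearD /= (linearB (galg_repr rG)) /=.
  by rewrite galg_repr_gomega -mulr2n.
rewrite plucker_weight_u linearZ linearB linearZ /= galg_repr_tperm_pair_sum QE.
have WC : W *m M = M *m W by rewrite scalar_mxC.
have -> : (omega x ^+ 2)%:C%:M = W *m W by rewrite -scalar_mxM -rmorphM.
have -> : (omega x *+ 4)%:C *: ((W - M) *+ 2) = W *m (W - M) *+ 8.
  by rewrite mul_scalar_mx rmorphMn -scalerMnl -scalerMnr -mulrnA.
have -> : (W - M) *+ 2 *m ((W - M) *+ 2) = (W - M) *m (W - M) *+ 4.
  by rewrite (mulrnA _ 2 2) !mulr2n mulmxDr mulmxDl.
have -> : (W - M) *m (W - M) *+ 4 - W *m (W - M) *+ 8
    = - (W *m W - M *m M) *+ 4.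
  rewrite (mulrnA _ 2 4) -mulrnBl mulr2n opprD addrA -mulmxBl.
  rewrite [W - M - W]addrAC subrr add0r mulNmx -opprD -mulmxDl.
  congr (- _ *+ 4).
  by rewrite mulmxBr !mulmxDl WC [M *m M + _]addrC opprD addrACA subrr add0r.
rewrite -scaler_nat scalerA scalerN -scaleNr; congr (_ *: _).
by rewrite -(rmorph_nat (real_complex R)) -rmorphM -rmorphN divfK ?pnatr_eq0.
Qed.

End Representation.

(** The common form through which both the positivity of the coordinate and the norm bound are
    compared with the two inequalities. *)
Lemma gle_calTP : gle (- gomega x) (calT x) /\ gle (calT x) (gomega x) <->
  forall (d : nat) (rG : mx_representation R[i] [set: 'S_m.+1] d),
    unitary_repr rG ->
    psdmx ((omega x ^+ 2)%:C%:M
      - galg_repr rG (calT x) *m galg_repr rG (calT x)).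
Proof.
have hT := gself_adjoint_calT; have hO := gself_adjoint_gomega.
have hN : gself_adjoint (- gomega x) by rewrite /gself_adjoint gstarN hO.
have reprD d (rG : mx_representation R[i] [set: 'S_m.+1] d) :
    galg_repr rG (calT x - - gomega x)
    = (omega x)%:C%:M + galg_repr rG (calT x).
  by rewrite opprK linearD /= galg_repr_gomega addrC.
have reprB d (rG : mx_representation R[i] [set: 'S_m.+1] d) :
    galg_repr rG (gomega x - calT x)
    = (omega x)%:C%:M - galg_repr rG (calT x).
  by rewrite (linearB (galg_repr rG)) /= galg_repr_gomega.
split=> [[[_ _ [_ p1]] [_ _ [_ p2]]] d rG uG|p].
  have hM := galg_repr_herm uG hT.
  apply/(psdmx_sub_sqr omega_gt0 hM); split; first by rewrite -reprB; exact: p2.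
  by rewrite -reprD; exact: p1.
have q d (rG : mx_representation R[i] [set: 'S_m.+1] d) (uG : unitary_repr rG) :=
  (psdmx_sub_sqr omega_gt0 (galg_repr_herm uG hT)).2 (p d rG uG).
have saD : gself_adjoint (calT x - - gomega x).
  by rewrite /gself_adjoint gstarD gstarN hT hN.
have saB : gself_adjoint (gomega x - calT x).
  by rewrite /gself_adjoint gstarD gstarN hT hO.
split; (split; first by []; first by []; split; first by []) => d rG uG.
  by rewrite reprD; exact: (q d rG uG).2.
by rewrite reprB; exact: (q d rG uG).1.
Qed.

Lemma gpsd_plucker : gpsd P <->
  gle (- gomega x) (calT x) /\ gle (calT x) (gomega x).
Proof.
have U0 : 0 < - U by rewrite oppr_gt0 prod_weight_y_lt0.
rewrite gle_calTP; split=> [[_ p] d rG uG|p].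
  by apply: (psdmxZ_inv U0); rewrite -galg_repr_plucker; exact: p.
split=> [|d rG uG]; first exact: gself_adjoint_plucker.
by rewrite galg_repr_plucker; exact: psdmxZ (ltW U0) (p d rG uG).
Qed.

Lemma gle_opnorm : gle (- gomega x) (calT x) /\ gle (calT x) (gomega x) <->
  forall (d : nat) (rG : mx_representation R[i] [set: 'S_m.+1] d),
    unitary_repr rG -> opnorm (galg_repr rG (calT x)) <= omega x.
Proof.
rewrite gle_calTP; split=> p d rG uG.
  apply/(opnorm_leP _ (ltW omega_gt0)).
  exact/(psdmx_l2norm (ltW omega_gt0) (galg_repr_herm uG gself_adjoint_calT))/p.
apply/(psdmx_l2norm (ltW omega_gt0) (galg_repr_herm uG gself_adjoint_calT)).
exact/(opnorm_leP _ (ltW omega_gt0))/p.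
Qed.

End Positivity.

(** * The endpoints in one-dimensional representations *)

Lemma scalar_repr (R : realType) (n : nat) (f : 'S_n -> R[i]) :
  f 1%g = 1 -> {morph f : s t / (s * t)%g >-> s * t} ->
  (forall s, f s * (f s)^* = 1) ->
  exists rG : mx_representation R[i] [set: 'S_n] 1,
    unitary_repr rG /\ forall s, rG s = (f s)%:M.
Proof.
move=> f1 fM fU.
have fP : mx_repr [set: 'S_n] (fun s => (f s)%:M : 'M_1).
  by split=> [|s t _ _]; rewrite ?f1 // fM scalar_mxM.
exists (MxRepresentation fP); split=> // s.
apply/unitarymxP; rewrite tr_scalar_mx map_scalar_mx -scalar_mxM.
by congr (_%:M); exact: fU.
Qed.

Lemma calT_eigenvalue (R : realType) (m : nat) (x : 'I_m -> R) (b : bool) :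
  exists (d : nat) (rG : mx_representation R[i] [set: 'S_m.+1] d),
    unitary_repr rG /\
    eigenvalue (galg_repr rG (calT x)) ((-1) ^+ b * omega x)%:C.
Proof.
(* The trivial character for [b = false] and the sign character for [b = true]. *)
pose f (s : 'S_m.+1) : R[i] := (-1) ^+ (b && odd_perm s).
have [rG [uG rGE]] : exists rG : mx_representation R[i] [set: 'S_m.+1] 1,
    unitary_repr rG /\ forall s, rG s = (f s)%:M.
  apply: scalar_repr => [|s t|s].
  - by rewrite /f odd_perm1 andbF.
  - by rewrite /f odd_permM andb_addr signr_addb.
  have -> : (f s)^*%R = f s by exact: rmorph_sign.
  by rewrite /f -signr_addb addbb.
exists 1%N, rG; split=> //.
rewrite (@galg_repr_calT_scalar _ _ _ _ _ ((-1) ^+ b)) => [|a c ac].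
  apply/eigenvalueP; exists (const_mx 1).
    by rewrite mul_mx_scalar.
  by apply/eqP => /matrixP/(_ 0 0); rewrite !mxE => /eqP; rewrite oner_eq0.
rewrite rGE /f odd_tperm ac andbT; congr (_%:M).
by rewrite rmorph_sign.
Qed.

Theorem corollary4p3 (R : realType) (m : nat) (hm : (2 <= m.+1)%N)
    (x : 'I_m -> R) (hx : forall i, 0 < x i) :
  [/\ gpsd (plucker [:: 2; 2]%N (weight_u x)) <->
        gle (- gomega x) (calT x) /\ gle (calT x) (gomega x),
      gle (- gomega x) (calT x) /\ gle (calT x) (gomega x) <->
        (forall (d : nat) (rG : mx_representation R[i] [set: 'S_m.+1] d),
           unitary_repr rG -> opnorm (galg_repr rG (calT x)) <= omega x),
      exists (d : nat) (rG : mx_representation R[i] [set: 'S_m.+1] d),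
        unitary_repr rG /\ eigenvalue (galg_repr rG (calT x)) (omega x)%:C
    & exists (d : nat) (rG : mx_representation R[i] [set: 'S_m.+1] d),
        unitary_repr rG /\ eigenvalue (galg_repr rG (calT x)) (- omega x)%:C].
Proof.
(* The hypothesis [hm] is convertible to [0 < m], the form in which these lemmas take it. *)
split; [exact: gpsd_plucker|exact: gle_opnorm| |].
  by have := calT_eigenvalue x false; rewrite expr0 mul1r.
by have := calT_eigenvalue x true; rewrite expr1 mulN1r.
Qed.
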